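(* (1) For all $1<p<2<q<\infty$ there is a Banach space $X$ with the modulus of convexity of power type $q$ and the modulus of smoothness of power type $p$, and a constant $c>0$, such that $$\frac1c\,n^{\frac1p-\frac1q}\le RUMD_n(X)\le c\,n^{\frac1p-\frac1q}\quad\text{for } n=1,2,\dots.$$ (2) There is a Banach space $X$ which, for all $1<p<2<q<\infty$, has the modulus of convexity of power type $q$ and the modulus of smoothness of power type $p$, and such that $RUMD_n(X)\to\infty$ as $n\to\infty$.
   Context: Banach spaces are over $\mathbb{K}$ (the real or complex scalars). Convention: ''the modulus of convexity (smoothness) of $X$ is of power type $r$'' means that there is some equivalent norm on $X$ whose modulus of convexity (smoothness) is of power type $r$, i.e. for that norm $\delta(\epsilon)\ge K\epsilon^r$ for $0<\epsilon\le 2$ (respectively $\rho(\tau)\le K\tau^r$ for $\tau>0$) for some constant $K>0$, where $\delta$ and $\rho$ are the usual moduli of convexity and smoothness. Let $\Omega_n=\{-1,1\}^n$ with the uniform probability $\mu_n(\{\omega\})=2^{-n}$, let $\mathcal{F}_0=\{\emptyset,\Omega_n\}$ and let $\mathcal{F}_k$ be the $\sigma$-algebra generated by the coordinates $\omega_1,\dots,\omega_k$. A Walsh-Paley martingale $\{M_k\}_0^n$ with values in $X$ is an $X$-valued martingale over $(\Omega_n,\mu_n)$ with respect to $\{\mathcal{F}_k\}_0^n$; $dM_k:=M_k-M_{k-1}$ for $k\ge1$. Let also $D_n=\{-1,1\}^n$ with uniform probability $P_n$; $\mathbb{E}_{\varepsilon,\omega}$ is the expectation with respect to $P_n\times\mu_n$.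 $RUMD_n(X)$ is the infimum of all $c>0$ such that $$\Big(\mathbb{E}_{\varepsilon,\omega}\Big\|\sum_{k=1}^n\varepsilon_k\,dM_k(\omega)\Big\|^2\Big)^{1/2}\le c\,\big(\mathbb{E}_\omega\|M_n(\omega)\|^2\big)^{1/2}$$ for all Walsh-Paley martingales $\{M_k\}_0^n$ with values in $X$ and $M_0=0$. *)

(* Defs.v *)
From HB Require Import structures.
From mathcomp Require Import all_boot all_order all_algebra.
From mathcomp Require Import complex.
From mathcomp Require Import all_classical all_reals all_analysis.

Set Implicit Arguments.
Unset Strict Implicit.
Unset Printing Implicit Defensive.

Import Order.TTheory GRing.Theory Num.Theory.
Import numFieldNormedType.Exports.

Local Open Scope classical_set_scope.
Local Open Scope ring_scope.

Inductive scalar_kind := RealScalars | ComplexScalars.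

Definition scalars (R : realType) (F : scalar_kind) : numFieldType :=
  match F with
  | RealScalars => R
  | ComplexScalars => R[i]
  end.

Definition re_scalar (R : realType) (F : scalar_kind) : scalars R F -> R :=
  match F with
  | RealScalars => fun a => a
  | ComplexScalars => fun a => complex.Re a
  end.

(* In a normed module over R[i] the norm takes its (real, nonnegative) values
   in R[i]; [abs_scalar] and [rnorm] transport such values to R. *)
Definition abs_scalar (R : realType) (F : scalar_kind) (a : scalars R F) : R :=
  re_scalar `|a|.

Definition rnorm (R : realType) (F : scalar_kind)
  (X : completeNormedModType (scalars R F)) (x : X) : R := re_scalar `|x|.

Section EquivalentNorms.
Context (R : realType) (F : scalar_kind).
Context (X : completeNormedModType (scalars R F)).

(* Definiteness and nonnegativity of [N] follow from the lower bound. *)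
Definition equivalent_norm (N : X -> R) : Prop :=
  [/\ forall x y, N (x + y) <= N x + N y,
      forall a x, N (a *: x) = abs_scalar a * N x
    & exists a b : R, [/\ 0 < a, 0 < b
        & forall x, a * rnorm x <= N x /\ N x <= b * rnorm x]].

Definition convexity_modulus (N : X -> R) (eps : R) : \bar R :=
  ereal_inf [set z | exists x y : X, [/\ N x = 1, N y = 1, eps <= N (x - y)
    & z = (1 - N (2^-1 *: (x + y)))%:E]].

Definition smoothness_modulus (N : X -> R) (tau : R) : \bar R :=
  ereal_sup [set z | exists x y : X, [/\ N x = 1, N y = tau
    & z = ((N (x + y) + N (x - y)) / 2 - 1)%:E]].

Definition convexity_power_type (r : R) : Prop :=
  exists N : X -> R, equivalent_norm N /\
    exists2 C : R, 0 < C & forall eps : R, 0 < eps -> eps <= 2 ->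
      ((C * eps `^ r)%:E <= convexity_modulus N eps)%E.

Definition smoothness_power_type (r : R) : Prop :=
  exists N : X -> R, equivalent_norm N /\
    exists2 C : R, 0 < C & forall tau : R, 0 < tau ->
      (smoothness_modulus N tau <= (C * tau `^ r)%:E)%E.

End EquivalentNorms.

(* {-1,1}^n, with [true] standing for -1 and [false] for 1. *)
Definition cube (n : nat) := {ffun 'I_n -> bool}.

(* Expectation for the uniform probability on a nonempty finite type. *)
Definition mean (K : numFieldType) (V : lmodType K) (T : finType)
  (f : T -> V) : V := (#|T|%:R : K)^-1 *: \sum_(w : T) f w.

(* The sigma-algebra generated by the first k coordinates. *)
Definition coord_sigma (n k : nat) : set (set (cube n)) :=
  <<s [set A | exists (i : 'I_n) (b : bool),
         (i < k)%N /\ A = [set w : cube n | w i = b]] >>.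
Arguments coord_sigma : clear implicits.

Section RUMD.
Context (R : realType) (F : scalar_kind).
Context (X : completeNormedModType (scalars R F)).

(* Measurability is with respect to the Borel sigma-algebra of X. *)
Definition coord_measurable (n k : nat) (f : cube n -> X) : Prop :=
  forall B : set X, <<s (@open X) >> B -> coord_sigma n k (f @^-1` B).

(* The last clause says that M k is the conditional expectation of M l given
   the first k coordinates.  Values M k with k > n are irrelevant. *)
Definition walsh_paley_martingale (n : nat) (M : nat -> cube n -> X) : Prop :=
  (forall k, (k <= n)%N -> coord_measurable k (M k)) /\
  (forall k l, (k <= l)%N -> (l <= n)%N ->
     forall A : set (cube n), coord_sigma n k A ->
       mean (fun w => (\1_A w : scalars R F) *: M l w) =
       mean (fun w => (\1_A w : scalars R F) *: M k w)).

Definition L2norm (T : finType) (f : T -> X) : R :=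
  Num.sqrt (mean (fun w => rnorm (f w) ^+ 2 : R^o)).

Definition RUMD (n : nat) : \bar R :=
  ereal_inf [set c%:E | c in [set c : R | 0 < c /\
    forall M : nat -> cube n -> X, walsh_paley_martingale M ->
      (forall w, M 0%N w = 0) ->
      L2norm (fun ew : cube n * cube n => \sum_(k < n)
        ((-1) ^+ ew.1 k : scalars R F) *: (M k.+1 ew.2 - M k ew.2))
      <= c * L2norm (M n)]].

End RUMD.

(* Main.v *)
(* The space X consists of functions on the infinite dyadic tree.  Its norm is
   defined by recursion from the leaves: the value at a node is put in
   l_q-relation with the pair formed by the norms of the two subtrees, which are
   themselves in l_p-relation.  By Minkowski's inequality this lattice norm is
   p-convex and q-concave with constant one, and together with two scalar
   two-point inequalities this gives power types q and p.

   Upper bound.  The two-point inequalities pass to L_2(X).  Applied to the steps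
   M_k +- dM_k of the martingale and S_k +- e_k dM_k of the signed sum they give
   sum |dM_k|^q <= C |M_n|^q and |S_n|^p <= C sum |dM_k|^p (norms in L_2(X)), and
   Hoelder's inequality yields the factor n^(1/p - 1/q).

   Lower bound.  Let M_n(w) be the indicator of the branch w of length n minus its
   mean.  A branch is an l_q-sum, so M_n has norm of order n^(1/q).  The n siblings
   of the nodes of the branch form an l_p-sum, and at each of them the randomized
   sum is at least 1/2 in mean, because the increment dM_k alone is 1/2 there.

   For the second part the exponents depend on the depth k in the tree, with
   1/p_k - 1/q_k = (2 + ln k)^(-1/2).  For fixed p < 2 < q only finitely many
   depths have exponents outside [p, q], and replacing these exponents by 2 gives
   an equivalent norm. *)
From HB Require Import structures.
Require Import Defs.
From mathcomp Require Import all_boot all_order all_algebra.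
From mathcomp Require Import complex ring lra.
From mathcomp Require Import all_classical all_reals all_analysis.

Set Implicit Arguments.
Unset Strict Implicit.
Unset Printing Implicit Defensive.

Import Order.TTheory GRing.Theory Num.Theory.
Import numFieldNormedType.Exports.

Local Open Scope classical_set_scope.
Local Open Scope ring_scope.

(** * Real powers and two-dimensional l_r norms *)

(* Locked, since otherwise a failed unification of two norms unfolds the real
   powers inside them. *)
HB.lock Definition lpnorm (R : realType) (I : finType) (r : R) (a : I -> R) : R :=
  (\sum_i a i `^ r) `^ r^-1.

HB.lock Definition lp2 (R : realType) (r a b : R) : R :=
  (a `^ r + b `^ r) `^ r^-1.

Section RealPowers.
Context {R : realType}.
Implicit Types (a b c d p q r s t x y : R).

Lemma ler_powR2r r x y : 0 <= r -> 0 <= x -> x <= y -> x `^ r <= y `^ r.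
Proof.
by move=> r0 x0 xy; apply: ge0_ler_powR; rewrite ?nnegrE ?(le_trans x0 xy).
Qed.

Lemma powRKV r x : 0 < r -> 0 <= x -> (x `^ r) `^ r^-1 = x.
Proof. by move=> r0 x0; rewrite -powRrM mulfV ?gt_eqF// powRr1. Qed.

Lemma powRVK r x : 0 < r -> 0 <= x -> (x `^ r^-1) `^ r = x.
Proof. by move=> r0 x0; rewrite -powRrM mulVf ?gt_eqF// powRr1. Qed.

Lemma ler_powRV r x y : 0 < r -> 0 <= x -> 0 <= y ->
  (x `^ r <= y) = (x <= y `^ r^-1).
Proof.
move=> r0 x0 y0; apply/idP/idP => h.
  by rewrite -[leLHS](powRKV r0 x0) ler_powR2r ?invr_ge0 ?powR_ge0 ?(ltW r0).
by rewrite -[leRHS](powRVK r0 y0) ler_powR2r ?(ltW r0).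
Qed.

Lemma bernoulli_powR_ge p t : 1 <= p -> 0 <= t -> 1 + p * (t - 1) <= t `^ p.
Proof.
rewrite le_eqVlt => /predU1P[<- t0|p1 t0]; first by rewrite powRr1//; lra.
have p0 : 0 < p by lra.
have q0 : 0 < 1 - p^-1 by rewrite subr_gt0 invf_lt1.
have := @conjugate_powR _ t 1 p (1 - p^-1)^-1 t0 ler01 p0.
rewrite invr_gt0 invrK powR1 mulr1 mul1r => /(_ q0) /(_ ltac:(by rewrite addrC subrK)).
rewrite -(ler_pM2l p0) mulrDr mulrBr mulrCA mulfV ?gt_eqF// !mulr1 => h.
lra.
Qed.

Lemma bernoulli_powR_le a t : 0 < a -> a <= 1 -> 0 <= t -> t `^ a <= 1 + a * (t - 1).
Proof.
move=> a0 a1 t0; have a1' : 1 <= a^-1 by rewrite invf_ge1.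
have := bernoulli_powR_ge a1' (powR_ge0 t a); rewrite powRKV//.
rewrite -(ler_pM2l a0) mulrDr mulrA mulfV ?gt_eqF//; lra.
Qed.

Lemma powR_ge_tangent p t x : 1 <= p -> 0 <= t -> 0 < x ->
  x `^ p + p * x `^ (p - 1) * (t - x) <= t `^ p.
Proof.
move=> p1 t0 x0; have tx0 : 0 <= t / x by rewrite divr_ge0// ltW.
have := bernoulli_powR_ge p1 tx0.
have x0' := ltW x0.
rewrite -(ler_pM2r (powR_gt0 p x0)) -powRM// divfK ?gt_eqF//.
apply: le_trans; rewrite mulrDl mul1r lerD2l.
rewrite -(@mulr_powRB1 _ x p)//; last lra.
rewrite le_eqVlt; apply/orP; left; apply/eqP.
by field; rewrite gt_eqF.
Qed.

Lemma powR_convex2 p (l x y : R) : 1 <= p -> 0 <= l -> l <= 1 -> 0 <= x -> 0 <= y ->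
  (l * x + (1 - l) * y) `^ p <= l * x `^ p + (1 - l) * y `^ p.
Proof.
move=> p1 l0 l1 x0 y0; set z := l * x + _.
have z0 : 0 <= z by rewrite addr_ge0// mulr_ge0// subr_ge0.
move: z0; rewrite le_eqVlt => /predU1P[<-|z0].
  rewrite powR0 ?addr_ge0 ?mulr_ge0 ?subr_ge0 ?powR_ge0// gt_eqF//; lra.
have hx := ler_wpM2l l0 (powR_ge_tangent p1 x0 z0).
have hy := @ler_wpM2l _ (1 - l) ltac:(lra) _ _ (powR_ge_tangent p1 y0 z0).
apply: le_trans (lerD hx hy); rewrite le_eqVlt; apply/orP; left; apply/eqP.
by rewrite /z; ring.
Qed.

Lemma lp2E r a b : lp2 r a b = lpnorm r (fun i : bool => if i then a else b).
Proof. by rewrite lpnorm.unlock lp2.unlock big_bool. Qed.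

Lemma lpnorm_ge0 (I : finType) r (a : I -> R) : 0 <= lpnorm r a.
Proof. by rewrite ?lpnorm.unlock ?lp2.unlock powR_ge0. Qed.

Lemma sum_powR_ge0 (I : finType) r (a : I -> R) : 0 <= \sum_i a i `^ r.
Proof. by apply: sumr_ge0 => i _; exact: powR_ge0. Qed.

Lemma lpnorm_powR (I : finType) r (a : I -> R) : 0 < r ->
  (lpnorm r a) `^ r = \sum_i a i `^ r.
Proof. by move=> r0; rewrite lpnorm.unlock powRVK ?sum_powR_ge0. Qed.

Lemma lpnorm_eq0 (I : finType) r (a : I -> R) : 0 < r -> (forall i, 0 <= a i) ->
  lpnorm r a = 0 -> forall i, a i = 0.
Proof.
rewrite lpnorm.unlock => r0 a0 /powR_eq0_eq0 /eqP; rewrite psumr_eq0; last by move=> *; exact: powR_ge0.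
move=> /allP h i; have := h i; rewrite mem_index_enum => /(_ isT).
by move=> /eqP /powR_eq0_eq0.
Qed.

Lemma eq_lpnorm (I : finType) r (a b : I -> R) : a =1 b -> lpnorm r a = lpnorm r b.
Proof. by move=> ab; rewrite lpnorm.unlock; under eq_bigr do rewrite ab. Qed.

Lemma minkowski_lpnorm (I : finType) r (a b : I -> R) : 1 <= r ->
  (forall i, 0 <= a i) -> (forall i, 0 <= b i) ->
  lpnorm r (fun i => a i + b i) <= lpnorm r a + lpnorm r b.
Proof.
move=> r1 a0 b0; have r0 : 0 < r by lra.
have [A0|A0] := eqVneq (lpnorm r a) 0.
  rewrite A0 add0r (@eq_lpnorm _ _ _ b)// => i.
  by rewrite (lpnorm_eq0 r0 a0 A0) add0r.
have [B0|B0] := eqVneq (lpnorm r b) 0.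
  rewrite B0 addr0 (@eq_lpnorm _ _ _ a)// => i.
  by rewrite (lpnorm_eq0 r0 b0 B0) addr0.
have {}A0 : 0 < lpnorm r a by rewrite lt0r A0 lpnorm_ge0.
have {}B0 : 0 < lpnorm r b by rewrite lt0r B0 lpnorm_ge0.
move: A0 B0; move AE : (lpnorm r a) => A; move BE : (lpnorm r b) => B A0 B0.
have AB0 : 0 < A + B by rewrite addr_gt0.
have A0' := ltW A0; have B0' := ltW B0; have AB0' := ltW AB0.
rewrite lpnorm.unlock ler_powRV ?invr_gt0 ?invrK ?sum_powR_ge0//.
rewrite -(@ler_pM2r _ ((A + B)^-1 `^ r)) ?powR_gt0 ?invr_gt0//.
rewrite -powRM ?invr_ge0// mulfV ?gt_eqF// powR1 mulr_suml.
pose l := A / (A + B).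
have l0 : 0 <= l := divr_ge0 A0' AB0'.
have l1 : l <= 1 by rewrite /l ler_pdivrMr// mul1r lerDl.
apply: (@le_trans _ _ (\sum_i (l * (a i / A) `^ r + (1 - l) * (b i / B) `^ r))).
  apply: ler_sum => i _; rewrite -powRM ?addr_ge0 ?invr_ge0//.
  apply: le_trans (powR_convex2 r1 l0 l1 _ _); rewrite ?divr_ge0//.
  rewrite le_eqVlt; apply/orP; left; apply/eqP; congr (_ `^ _).
  by rewrite /l; field; rewrite !gt_eqF.
rewrite big_split/= -!mulr_sumr.
have E (c : I -> R) C : (forall i, 0 <= c i) -> 0 < C -> C = lpnorm r c ->
    \sum_i (c i / C) `^ r = 1.
  move=> c0 C0 CE; have C0' := ltW C0.
  under eq_bigr do rewrite powRM ?invr_ge0//.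
  rewrite -mulr_suml -lpnorm_powR// -CE -powRM ?invr_ge0//.
  by rewrite mulfV ?gt_eqF// powR1.
by rewrite (E a A)// (E b B)// !mulr1 addrC subrK.
Qed.

Lemma lp2_def r a b : lp2 r a b = (a `^ r + b `^ r) `^ r^-1.
Proof. by rewrite lp2.unlock. Qed.

Lemma lp2_ge0 r a b : 0 <= lp2 r a b. Proof. by rewrite ?lpnorm.unlock ?lp2.unlock powR_ge0. Qed.

Lemma lp2_powR r a b : 0 < r -> (lp2 r a b) `^ r = a `^ r + b `^ r.
Proof. by move=> r0; rewrite lp2.unlock powRVK// addr_ge0 ?powR_ge0. Qed.

Lemma lp2r0 r a : 0 < r -> 0 <= a -> lp2 r a 0 = a.
Proof. by move=> r0 a0; rewrite !lp2.unlock powR0 ?gt_eqF// addr0 powRKV. Qed.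

Lemma lp2C r a b : lp2 r a b = lp2 r b a.
Proof. by rewrite !lp2.unlock addrC. Qed.

Lemma lp20r r a : 0 < r -> 0 <= a -> lp2 r 0 a = a.
Proof. by move=> r0 a0; rewrite lp2C lp2r0. Qed.

Lemma ler_lp2 r a b c d : 0 < r -> 0 <= a -> 0 <= b -> a <= c -> b <= d ->
  lp2 r a b <= lp2 r c d.
Proof.
move=> r0 a0 b0 ac bd; have r0' := ltW r0; rewrite !lp2_def; apply: ler_powR2r.
- by rewrite invr_ge0.
- by rewrite addr_ge0 ?powR_ge0.
- by rewrite lerD// ler_powR2r.
Qed.

Lemma lp2_ge_l r a b : 0 < r -> 0 <= a -> 0 <= b -> a <= lp2 r a b.
Proof. by move=> r0 a0 b0; rewrite -[leLHS](@lp2r0 r a)//; apply: ler_lp2. Qed.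

Lemma lp2_ge_r r a b : 0 < r -> 0 <= a -> 0 <= b -> b <= lp2 r a b.
Proof. by move=> *; rewrite lp2C lp2_ge_l. Qed.

Lemma lp2Z r c a b : 0 < r -> 0 <= c -> 0 <= a -> 0 <= b ->
  lp2 r (c * a) (c * b) = c * lp2 r a b.
Proof.
move=> r0 c0 a0 b0; rewrite !lp2_def !powRM// -mulrDr powRM ?powR_ge0 ?addr_ge0 ?powR_ge0//.
by rewrite powRKV.
Qed.

Lemma lp2D r a b c d : 1 <= r -> 0 <= a -> 0 <= b -> 0 <= c -> 0 <= d ->
  lp2 r (a + b) (c + d) <= lp2 r a c + lp2 r b d.
Proof.
move=> r1 a0 b0 c0 d0; rewrite !lp2E.
have := @minkowski_lpnorm _ r (fun i : bool => if i then a else c)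
  (fun i : bool => if i then b else d) r1.
move=> /(_ ltac:(by case)) /(_ ltac:(by case)).
by apply: le_trans; rewrite le_eqVlt; apply/orP; left; apply/eqP/eq_lpnorm; case.
Qed.

Lemma lp2_sum (I : finType) r (a b : I -> R) : 1 <= r ->
  (forall i, 0 <= a i) -> (forall i, 0 <= b i) ->
  lp2 r (\sum_i a i) (\sum_i b i) <= \sum_i lp2 r (a i) (b i).
Proof.
move=> r1 a0 b0; pose P (x y z : R) := 0 <= x /\ 0 <= y /\ lp2 r x y <= z.
suff : P (\sum_i a i) (\sum_i b i) (\sum_i lp2 r (a i) (b i)) by case=> ? [].
apply: (big_ind3 P) => //; first by rewrite /P !lexx lp2r0//; lra.
move=> x y z x' y' z' [x0 [y0 h]] [x0' [y0' h']].
split; first exact: addr_ge0.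
split; first exact: addr_ge0.
by rewrite (le_trans (lp2D _ _ _ _ _))// lerD.
Qed.

Lemma lp2_swap p r a b c d : 0 < p -> p <= r ->
  0 <= a -> 0 <= b -> 0 <= c -> 0 <= d ->
  lp2 r (lp2 p a b) (lp2 p c d) <= lp2 p (lp2 r a c) (lp2 r b d).
Proof.
move=> p0 pr a0 b0 c0 d0; have r0 : 0 < r by lra.
have rp1 : 1 <= r / p by rewrite ler_pdivlMr// mul1r.
have E x y : 0 <= x -> 0 <= y -> (lp2 r x y) `^ p = lp2 (r / p) (x `^ p) (y `^ p).
  move=> x0 y0; rewrite !lp2_def -!powRrM invf_div [r^-1 * p]mulrC.
  by rewrite [p * (r / p)]mulrC divfK ?gt_eqF.
rewrite (lp2_def p (lp2 r a c)) -ler_powRV ?addr_ge0 ?powR_ge0 ?lp2_ge0//.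
rewrite E ?lp2_ge0// !lp2_powR// !E//.
by apply: lp2D; rewrite ?powR_ge0.
Qed.

Lemma ler_lp2_exponent p r a b : 0 < p -> p <= r -> 0 <= a -> 0 <= b ->
  lp2 r a b <= lp2 p a b.
Proof.
move=> p0 pr a0 b0; have r0 : 0 < r by lra.
have := lp2_ge0 p a b; rewrite le_eqVlt => /predU1P[m0|m0].
  have := lp2_ge_l p0 a0 b0; have := lp2_ge_r p0 a0 b0; rewrite -m0 => hb ha.
  have -> : a = 0 by apply: le_anti; rewrite ha.
  have -> : b = 0 by apply: le_anti; rewrite hb.
  by rewrite lp2r0.
have am : a <= lp2 p a b by exact: lp2_ge_l.
have bm : b <= lp2 p a b by exact: lp2_ge_r.
have mE := lp2_powR a b p0.
move: (lp2 p a b) m0 am bm mE => m m0; have m0' := ltW m0.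
rewrite -[in X in X -> _](mul1r m) -ler_pdivrMr// => am.
rewrite -[in X in X -> _](mul1r m) -ler_pdivrMr// => bm mE.
have am0 : 0 <= a / m by rewrite divr_ge0.
have bm0 : 0 <= b / m by rewrite divr_ge0.
have E x : 0 <= x -> x = m * (x / m) by move=> x0; rewrite mulrC divfK// gt_eqF.
rewrite [in leLHS](E a)// [in leLHS](E b)// lp2Z// ler_piMr//.
have le1 x : 0 <= x -> x <= 1 -> x `^ r <= x `^ p.
  rewrite le_eqVlt => /predU1P[<- _|x0 x1]; first by rewrite !powR0// gt_eqF.
  by apply: ger_powR; rewrite ?x0.
rewrite lp2_def ler_powRV ?invr_gt0 ?invrK ?addr_ge0 ?powR_ge0// powR1.
apply: le_trans (lerD (le1 _ am0 am) (le1 _ bm0 bm)) _.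
rewrite !powRM ?invr_ge0// -mulrDl -mE -powRM ?invr_ge0//.
by rewrite mulfV ?gt_eqF// powR1.
Qed.

Lemma lp2_le_add r a b : 1 <= r -> 0 <= a -> 0 <= b -> lp2 r a b <= a + b.
Proof.
move=> r1 a0 b0; apply: le_trans (ler_lp2_exponent ltr01 r1 a0 b0) _.
by rewrite lp2_def invr1 !powRr1// addr_ge0.
Qed.

Lemma lp2_ge_add r a b : 0 < r -> 0 <= a -> 0 <= b -> a + b <= 2 * lp2 r a b.
Proof.
move=> r0 a0 b0; have := lp2_ge_l r0 a0 b0; have := lp2_ge_r r0 a0 b0; lra.
Qed.

Lemma sum_powR_le (I : finType) a (y : I -> R) : 0 < a -> a <= 1 -> (forall i, 0 <= y i) ->
  \sum_i y i `^ a <= #|I|%:R `^ (1 - a) * (\sum_i y i) `^ a.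
Proof.
move=> a0 a1 y0; set S := \sum_i y i.
have S0 : 0 <= S by apply: sumr_ge0.
have n0 : 0 <= #|I|%:R :> R by [].
have [S00|] := eqVneq S 0.
  rewrite big1 ?mulr_ge0 ?powR_ge0// => i _.
  move: S00 => /eqP; rewrite psumr_eq0// => /allP /(_ i).
  by rewrite mem_index_enum => /(_ isT)/eqP->; rewrite powR0// gt_eqF.
move=> Sn0; have {}S0 : 0 < S by rewrite lt0r Sn0.
have [I0|I0] := eqVneq #|I| 0%N.
  rewrite big1 ?mulr_ge0 ?powR_ge0// => i _.
  by move: (fintype0 i); rewrite I0.
have {}n0 : 0 < #|I|%:R :> R by rewrite ltr0n lt0n.
set n := #|I|%:R in n0 *; pose m := S / n.
have m0 : 0 < m by rewrite divr_gt0.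
have m0' := ltW m0.
apply: (@le_trans _ _ (\sum_i m `^ a * (1 + a * (y i / m - 1)))).
  apply: ler_sum => i _; have ym0 : 0 <= y i / m by rewrite divr_ge0.
  have := ler_wpM2l (powR_ge0 m a) (bernoulli_powR_le a0 a1 ym0).
  rewrite -powRM//.
  by rewrite (_ : m * (y i / m) = y i)// mulrC divfK ?gt_eqF.
have Sm : S / m = n by rewrite /m invf_div mulrCA mulfV ?mulr1 ?gt_eqF.
rewrite -mulr_sumr (_ : \sum_i _ = n); last first.
  by rewrite big_split/= -mulr_sumr sumrB -mulr_suml !sumr_const -/S Sm subrr mulr0 addr0.
rewrite /m powRM ?invr_ge0 ?(ltW n0) ?(ltW S0)//.
rewrite -powR_inv1 ?(ltW n0)// -powRrM mulN1r powRD ?(gt_eqF n0) ?implybT//.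
by rewrite powRr1 ?(ltW n0)// -mulrA mulrC [n * _]mulrC.
Qed.

End RealPowers.

(** * Two-point inequalities for scalars *)

HB.lock Definition mean2 (R : realType) (r a b : R) : R :=
  ((a `^ r + b `^ r) / 2) `^ r^-1.

Section TwoPoint.
Context {R : realType}.
Implicit Types (a b c d k p q r s t x y u v : R).

Lemma mean2_lp2 r a b : 0 < r -> 0 <= a -> 0 <= b ->
  mean2 r a b = lp2 r (2^-1 `^ r^-1 * a) (2^-1 `^ r^-1 * b).
Proof.
move=> r0 a0 b0; rewrite mean2.unlock lp2_def.
by rewrite [in RHS]powRM ?powR_ge0// [in X in _ = (_ + X) `^ _]powRM ?powR_ge0// powRVK// -mulrDr mulrC.
Qed.

Lemma mean2_ge0 r a b : 0 <= mean2 r a b.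
Proof. by rewrite mean2.unlock powR_ge0. Qed.

Lemma mean2Z r c a b : 0 < r -> 0 <= c -> 0 <= a -> 0 <= b ->
  mean2 r (c * a) (c * b) = c * mean2 r a b.
Proof.
move=> r0 c0 a0 b0; rewrite !mean2_lp2 ?mulr_ge0// ![_ * (c * _)]mulrCA.
by rewrite !lp2Z ?mulr_ge0 ?powR_ge0 ?invr_ge0.
Qed.

Lemma ler_mean2_exponent p r a b : 0 < p -> p <= r -> 0 <= a -> 0 <= b ->
  mean2 p a b <= mean2 r a b.
Proof.
move=> p0 pr a0 b0; rewrite mean2.unlock.
have r0 : 0 < r by exact: lt_le_trans pr.
have rp : 1 <= r / p by rewrite ler_pdivlMr// mul1r.
rewrite -ler_powRV ?divr_ge0 ?addr_ge0 ?powR_ge0// -powRrM.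
have /(_ _ _ (powR_ge0 a p) (powR_ge0 b p)) :=
  @powR_convex2 _ (r / p) 2^-1 _ _ rp ltac:(lra) ltac:(lra).
rewrite -!powRrM [p * (r / p)]mulrC divfK ?gt_eqF// [p^-1 * r]mulrC.
rewrite (_ : 1 - 2^-1 = 2^-1 :> R); last by lra.
by rewrite -!mulrDr ![2^-1 * _]mulrC.
Qed.

Lemma mean2_2 a b : 0 <= a -> 0 <= b -> (mean2 2 a b) ^+ 2 = (a ^+ 2 + b ^+ 2) / 2.
Proof.
move=> a0 b0; rewrite mean2.unlock -powR_mulrn ?powR_ge0// powRVK//; last first.
  by rewrite divr_ge0 ?addr_ge0 ?powR_ge0.
by rewrite !powR_mulrn.
Qed.

Lemma powR_ge_quadratic p t : 1 < p -> p <= 2 -> 0 <= t -> t <= 2 ->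
  1 + p * (t - 1) + p * (p - 1) / 6 * (t - 1) ^+ 2 <= t `^ p.
Proof.
(* Two tangent inequalities, at [1] and at the midpoint [a] of [1] and [t]; the
   quadratic gain is the change of slope between them. *)
move=> p1 p2 t0 t2; pose a := (1 + t) / 2.
have a0 : 0 < a by rewrite /a; lra.
have h1 := powR_ge_tangent (ltW p1) t0 a0.
have h2 := bernoulli_powR_ge (ltW p1) (ltW a0).
have e0 : 0 < p - 1 by lra.
have e1 : p - 1 <= 1 by lra.
have h3 : 2 / 3 * (p - 1) * (a - 1) ^+ 2 <= (a `^ (p - 1) - 1) * (a - 1).
  have [a1|a1] := leP a 1.
    have := ler_wpM2r (_ : 0 <= 1 - a) (bernoulli_powR_le e0 e1 (ltW a0)).
    move=> /(_ ltac:(lra)).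
    have : 0 <= (p - 1) * (a - 1) ^+ 2 by rewrite mulr_ge0 ?sqr_ge0// ltW.
    by move: (a `^ (p - 1)) => A; lra.
  have := @bernoulli_powR_le _ (p - 1) a^-1 e0 e1.
  rewrite invr_ge0 ltW// => /(_ isT).
  have A1 : 1 <= a `^ (p - 1) by rewrite -[leLHS](powRr0 a) ler_powR ?(ltW a1) ?(ltW e0).
  move=> /(ler_wpM2l (powR_ge0 a (p - 1))).
  rewrite -powRM ?invr_ge0 ?(ltW a0)// mulfV ?gt_eqF// powR1 => h.
  have : 2/3 <= a^-1.
    rewrite -[leRHS]mul1r ler_pdivlMr//; rewrite /a; lra.
  have : a^-1 - 1 = - (a - 1) * a^-1 by field; rewrite gt_eqF.
  move: h; move: (a `^ (p-1)) A1 (a^-1) => A A1 b h bE b23.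
  rewrite bE in h.
  have : (p - 1) * (a - 1) * (2/3) <= A - 1.
    have : A * ((p-1) * (a - 1) * b) <= A - 1 by move: h; lra.
    apply: le_trans; rewrite -[leLHS]mul1r.
    apply: ler_pM => //; first by rewrite mulr_ge0// mulr_ge0; lra.
    by rewrite ler_pM2l// mulr_gt0; lra.
  move=> h'; have a10 : 0 <= a - 1 by lra.
  have := ler_wpM2r a10 h'; lra.
move: h1; have -> : t - a = a - 1 by rewrite /a; field.
have -> : t - 1 = 2 * (a - 1) by rewrite /a; field.
have := @ler_wpM2l _ p ltac:(lra) _ _ h3.
clear h3; clearbody a; move: (a `^ (p - 1)) (a `^ p) (t `^ p) h2 => A B C; lra.
Qed.

Lemma powR_le_quadratic q t : 2 <= q -> 0 <= t -> t <= 2 ->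
  t `^ q <= 1 + q * (t - 1) + q * (q - 1) * 2 `^ q * (t - 1) ^+ 2.
Proof.
move=> q2 t0 t2; have q1 : 1 <= q by lra.
have Q1 : 1 <= 2 `^ q :> R.
  by rewrite -[leLHS](powRr0 2) ler_powR// ?ler1n//; lra.
move: t0; rewrite le_eqVlt => /predU1P[<-|t0].
  rewrite powR0 ?gt_eqF//; last lra.
  have : q * (q - 1) <= q * (q - 1) * 2 `^ q by rewrite ler_peMr// mulr_ge0; lra.
  nra.
have h1 := @powR_ge_tangent _ q 1 t q1 ler01 t0.
have q1' : 1 <= q - 1 by lra.
have h2 : (t `^ (q - 1) - 1) * (t - 1) <= (q - 1) * 2 `^ q * (t - 1) ^+ 2.
  have [t1|t1] := leP t 1.
    have := bernoulli_powR_ge q1' (ltW t0) => h.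
    apply: (@le_trans _ _ ((q - 1) * (t - 1) ^+ 2)).
      by nra.
    by rewrite ler_wpM2r ?sqr_ge0// ler_peMr//; lra.
  have := @powR_ge_tangent _ (q - 1) 1 t q1' ler01 t0; rewrite powR1 => h.
  have : t `^ (q - 1 - 1) <= 2 `^ q.
    apply: (@le_trans _ _ (2 `^ (q - 1 - 1))); first by apply: ler_powR2r; lra.
    by rewrite ler_powR ?ler1n//; lra.
  move: h; move: (2 `^ q) (t `^ (q - 1 - 1)) (t `^ (q - 1)) => A B C h BA.
  have : C - 1 <= (q - 1) * A * (t - 1).
    apply: (@le_trans _ _ ((q - 1) * B * (t - 1))); first lra.
    by apply: ler_wpM2r; [lra | apply: ler_wpM2l => //; lra].
  move=> /(@ler_wpM2r _ (t - 1) ltac:(lra)); lra.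
move: h1; rewrite powR1; have := @ler_wpM2l _ q ltac:(lra) _ _ h2.
move: (2 `^ q) (t `^ (q - 1)) (t `^ q) => A B C; lra.
Qed.

(* Two numbers [u], [v] that can arise as [`|x + y|] and [`|x - y|] for vectors
   of a Euclidean plane with [`|x| = r] and [`|y| = s]. *)
Definition diagonals r s u v :=
  [/\ 0 <= r, 0 <= s, 0 <= u & 0 <= v] /\
  [/\ u ^+ 2 + v ^+ 2 = 2 * (r ^+ 2 + s ^+ 2),
      2 * r <= u + v, 2 * s <= u + v, u <= r + s & v <= r + s].

Lemma diagonalsC r s u v : diagonals r s u v -> diagonals s r u v.
Proof.
move=> [[? ? ? ?] [h ? ? ? ?]]; split; split=> //; rewrite ?[s + r]addrC//.
by rewrite h [s ^+ 2 + _]addrC.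
Qed.

Lemma diagonalsZ c r s u v : 0 <= c -> diagonals r s u v ->
  diagonals (c * r) (c * s) (c * u) (c * v).
Proof.
move=> c0 [[? ? ? ?] [h ? ? ? ?]]; split; split; rewrite ?mulr_ge0//.
- by rewrite !exprMn -mulrDr h; ring.
- by rewrite mulrCA -mulrDr ler_wpM2l.
- by rewrite mulrCA -mulrDr ler_wpM2l.
- by rewrite -mulrDr ler_wpM2l.
- by rewrite -mulrDr ler_wpM2l.
Qed.

Lemma diagonals_powR_ge p s u v : 1 < p -> p <= 2 -> s <= 1 -> diagonals 1 s u v ->
  1 + p * (p - 1) / 6 * s ^+ 2 <= (u `^ p + v `^ p) / 2.
Proof.
move=> p1 p2 s1 [[_ s0 u0 v0] [uv uv1 uv2 us vs]].
have := @powR_ge_quadratic p u p1 p2 u0 ltac:(lra).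
have := @powR_ge_quadratic p v p1 p2 v0 ltac:(lra).
move: (u `^ p) (v `^ p) => U V hV hU.
have k0 : 0 <= (p - 2 * (p * (p - 1) / 6)) * (u + v - 2).
  by apply: mulr_ge0; [nra | lra].
set k := p * (p - 1) / 6 in k0 hU hV *.
suff : k * ((u - 1) ^+ 2 + (v - 1) ^+ 2) = k * (2 * s ^+ 2 + 4 - 2 * (u + v)) by lra.
congr (_ * _).
have -> : (u - 1) ^+ 2 + (v - 1) ^+ 2 = u ^+ 2 + v ^+ 2 + 2 - 2 * (u + v) by ring.
by rewrite uv; ring.
Qed.

Lemma diagonals_powR_le q s u v : 2 <= q -> s <= 1 -> diagonals 1 s u v ->
  (u `^ q + v `^ q) / 2 <= 1 + q * (q - 1) * 2 `^ q * s ^+ 2.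
Proof.
move=> q2 s1 [[_ s0 u0 v0] [uv uv1 uv2 us vs]].
have := @powR_le_quadratic q u q2 u0 ltac:(lra).
have := @powR_le_quadratic q v q2 v0 ltac:(lra).
move: (u `^ q) (v `^ q) => U V hV hU.
have Q1 : 1 <= 2 `^ q :> R.
  by rewrite -[leLHS](powRr0 2) ler_powR// ?ler1n//; lra.
have k0 : 0 <= (2 * (q * (q - 1) * 2 `^ q) - q) * (u + v - 2).
  apply: mulr_ge0; last lra.
  have : q * (q - 1) <= q * (q - 1) * 2 `^ q by rewrite ler_peMr// mulr_ge0; lra.
  nra.
set k := q * (q - 1) * 2 `^ q in k0 hU hV *.
suff : k * ((u - 1) ^+ 2 + (v - 1) ^+ 2) = k * (2 * s ^+ 2 + 4 - 2 * (u + v)) by lra.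
congr (_ * _).
have -> : (u - 1) ^+ 2 + (v - 1) ^+ 2 = u ^+ 2 + v ^+ 2 + 2 - 2 * (u + v) by ring.
by rewrite uv; ring.
Qed.

Lemma diagonals_convex p q : 1 < p -> p <= 2 -> 2 <= q ->
  exists2 k : R, 0 < k &
    forall r s u v, diagonals r s u v -> lp2 q r (k * s) <= mean2 p u v.
Proof.
move=> p1 p2 q2; pose kk := p * (p - 1) / 6.
have kk0 : 0 < kk by rewrite /kk; nra.
have kk1 : kk <= 1 by rewrite /kk; nra.
have kkE : p * (p - 1) / 6 = kk by [].
clearbody kk.
have p0 : 0 < p by lra.
have [two0 half0] : (0 < 2 :> R) /\ (0 < 2^-1 :> R) by split; lra.
exists (kk `^ 2^-1); first exact: powR_gt0.
have K2 x y : 0 <= y -> lp2 2 x (kk `^ 2^-1 * y) = (x `^ 2 + kk * y ^+ 2) `^ 2^-1.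
  move=> y0; rewrite lp2_def powRM ?powR_ge0// powRVK ?(ltW kk0)//.
  by rewrite [y `^ 2](@powR_mulrn _ _ 2).
suff H r s u v : diagonals r s u v -> s <= r ->
    lp2 2 r (kk `^ 2^-1 * s) <= mean2 p u v.
  move=> r s u v d; have [[r0 s0 u0 v0] _] := d.
  apply: (@le_trans _ _ (lp2 2 r (kk `^ 2^-1 * s))).
    by apply: ler_lp2_exponent; rewrite ?mulr_ge0 ?powR_ge0.
  have [sr|/ltW rs] := leP s r; first exact: H.
  apply: le_trans (H _ _ _ _ (diagonalsC d) rs).
  rewrite !K2// ler_powR2r ?addr_ge0 ?mulr_ge0 ?powR_ge0 ?sqr_ge0 ?(ltW kk0) ?invr_ge0//.
  rewrite !(@powR_mulrn _ _ 2)//; have : 0 <= (1 - kk) * (s ^+ 2 - r ^+ 2).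
    by rewrite mulr_ge0 ?subr_ge0// ler_sqr.
  by lra.
move=> d sr; have [[r0 s0 u0 v0] [_ _ _ ur vr]] := d.
move: r0; rewrite le_eqVlt => /predU1P[r00|r0].
  have s00 : s = 0 by apply: le_anti; rewrite s0 r00 sr.
  by rewrite -r00 s00 mulr0 lp2r0// mean2_ge0.
have r0' := ltW r0.
have d1 : diagonals 1 (r^-1 * s) (r^-1 * u) (r^-1 * v).
  rewrite (_ : 1 = r^-1 * r); last by rewrite mulVf ?gt_eqF.
  by apply: diagonalsZ; rewrite ?invr_ge0.
have s1 : r^-1 * s <= 1 by rewrite mulrC ler_pdivrMr// mul1r.
have := diagonals_powR_ge p1 p2 s1 d1; rewrite kkE => h.
have [[_ s0' u0' v0'] _] := d1.
have E x : x = r * (r^-1 * x) by rewrite mulrA mulfV ?mul1r ?gt_eqF.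
have B1 : 1 <= 1 + kk * (r^-1 * s) ^+ 2 by rewrite lerDl mulr_ge0 ?sqr_ge0// ltW.
have M : (1 + kk * (r^-1 * s) ^+ 2) `^ 2^-1 <= mean2 p (r^-1 * u) (r^-1 * v).
  apply: (@le_trans _ _ ((1 + kk * (r^-1 * s) ^+ 2) `^ p^-1)).
    by rewrite ler_powR// lef_pV2.
  rewrite mean2.unlock ler_powR2r ?invr_ge0 ?(ltW p0)//.
  exact: le_trans B1.
have R1 : r^-1 * r = 1 by rewrite mulVf ?gt_eqF.
rewrite (E u) (E v) mean2Z//.
have -> : lp2 2 r (kk `^ 2^-1 * s) = r * lp2 2 1 (kk `^ 2^-1 * (r^-1 * s)).
  by rewrite -lp2Z ?mulr_ge0 ?invr_ge0 ?powR_ge0// mulr1 [in RHS]mulrCA -(E s).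
by rewrite ler_pM2l// K2// powR1.
Qed.

Lemma diagonals_smooth p q : 1 < p -> p <= 2 -> 2 <= q ->
  exists2 k : R, 0 < k &
    forall r s u v, diagonals r s u v -> mean2 q u v <= lp2 p r (k * s).
Proof.
move=> p1 p2 q2; pose k := q * (q - 1) * 2 `^ q.
have p0 : 0 < p by lra.
have q0 : 0 < q by lra.
have k2 : 2 <= k.
  have Q1 : 1 <= 2 `^ q :> R.
    by rewrite -[leLHS](powRr0 2) ler_powR// ?ler1n//; lra.
  have : q * (q - 1) <= k by rewrite ler_peMr// mulr_ge0; lra.
  by nra.
have k0 : 0 < k by lra.
have kE : q * (q - 1) * 2 `^ q = k by [].
clearbody k; exists k => // r s u v d; have [[r0 s0 u0 v0] [_ _ _ ur vr]] := d.
have [rs|sr] := leP r s.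
  apply: (@le_trans _ _ (2 * s)); last first.
    apply: le_trans (lp2_ge_r p0 r0 _); last by rewrite mulr_ge0 ?(ltW k0).
    by rewrite ler_wpM2r.
  rewrite mean2.unlock ler_powRV ?invr_gt0 ?invrK ?divr_ge0 ?addr_ge0 ?mulr_ge0 ?powR_ge0//.
  have hu : u `^ q <= (2 * s) `^ q by apply: ler_powR2r; rewrite ?(ltW q0)//; lra.
  have hv : v `^ q <= (2 * s) `^ q by apply: ler_powR2r; rewrite ?(ltW q0)//; lra.
  by rewrite ler_pdivrMr//; lra.
have {}r0 : 0 < r by exact: le_lt_trans sr.
have r0' := ltW r0.
have d1 : diagonals 1 (r^-1 * s) (r^-1 * u) (r^-1 * v).
  rewrite (_ : 1 = r^-1 * r); last by rewrite mulVf ?gt_eqF.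
  by apply: diagonalsZ; rewrite ?invr_ge0.
have s1 : r^-1 * s <= 1 by rewrite mulrC ler_pdivrMr// mul1r ltW.
have := diagonals_powR_le q2 s1 d1; rewrite kE => h.
have [[_ s0' u0' v0'] _] := d1.
have E x : x = r * (r^-1 * x) by rewrite mulrA mulfV ?mul1r ?gt_eqF.
rewrite (E u) (E v) mean2Z//.
have -> : lp2 p r (k * s) = r * lp2 p 1 (k * (r^-1 * s)).
  by rewrite -lp2Z ?mulr_ge0 ?invr_ge0 ?(ltW k0)// mulr1 [in RHS]mulrCA -(E s).
rewrite ler_pM2l//; move: {d d1 ur vr E h} (r^-1 * s) (r^-1 * u) (r^-1 * v) s0' u0' v0' s1 h.
move=> a b c a0 b0 c0 a1 h.
have B1 : 1 <= 1 + k * a ^+ 2 by rewrite lerDl mulr_ge0 ?sqr_ge0// ltW.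
rewrite mean2.unlock lp2_def powR1.
apply: (@le_trans _ _ ((1 + k * a ^+ 2) `^ q^-1)).
  by rewrite ler_powR2r ?invr_ge0 ?(ltW q0)// divr_ge0 ?addr_ge0 ?powR_ge0.
apply: (@le_trans _ _ ((1 + k * a ^+ 2) `^ p^-1)).
  by rewrite ler_powR// lef_pV2// (le_trans p2).
rewrite ler_powR2r ?invr_ge0 ?(ltW p0) ?(le_trans ler01 B1)// lerD2l.
rewrite powRM ?(ltW k0)//; apply: ler_pM; rewrite ?sqr_ge0 ?(ltW k0)//.
  by rewrite le1r_powR ?(ltW p1)//; lra.
move: a0; rewrite le_eqVlt => /predU1P[<-|a0]; first by rewrite expr0n powR_ge0.
by rewrite -[leLHS](@powR_mulrn _ _ 2) ?(ltW a0)//; apply: ger_powR; rewrite ?a0.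
Qed.

End TwoPoint.

(** * Norms of functions on the dyadic tree *)

(* Nodes of the infinite dyadic tree are words [t : seq bool].  At depth [k] the
   root of a subtree is in [l_(qq k)]-relation with the rest, and its two
   subtrees are in [l_(pp k)]-relation with each other. *)
Fixpoint tree_norm (R : realType) (pp qq : nat -> R) (n k : nat)
    (g : seq bool -> R) : R :=
  if n is m.+1 then
    lp2 (qq k) (g [::])
      (lp2 (pp k) (tree_norm pp qq m k.+1 (fun t => g (false :: t)))
                  (tree_norm pp qq m k.+1 (fun t => g (true :: t))))
  else 0.

Section TreeNorm.
Context {R : realType} (pp qq : nat -> R).
Hypothesis pp1 : forall k, 1 <= pp k.
Hypothesis qq1 : forall k, 1 <= qq k.
Implicit Types (g h : seq bool -> R) (n k : nat).

Local Notation nu := (tree_norm pp qq).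

Let pp0 k : 0 < pp k. Proof. exact: lt_le_trans (pp1 k). Qed.
Let qq0 k : 0 < qq k. Proof. exact: lt_le_trans (qq1 k). Qed.

Lemma tree_norm_ge0 n k g : 0 <= nu n k g.
Proof. by case: n => [//|n]; exact: lp2_ge0. Qed.

Lemma tree_normS n k g : nu n.+1 k g =
  lp2 (qq k) (g [::]) (lp2 (pp k) (nu n k.+1 (fun t => g (false :: t)))
                                  (nu n k.+1 (fun t => g (true :: t)))).
Proof. by []. Qed.

Hint Resolve pp0 qq0 lp2_ge0 tree_norm_ge0 : core.

Lemma eq_tree_norm n k g h : g =1 h -> nu n k g = nu n k h.
Proof.
elim: n k g h => [//|n IH] k g h gh /=.
by rewrite gh; congr (lp2 _ _ (lp2 _ _ _)); apply: IH => t; exact: gh.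
Qed.

Lemma ler_tree_norm n k g h :
  (forall t, (size t < n)%N -> 0 <= g t) ->
  (forall t, (size t < n)%N -> g t <= h t) -> nu n k g <= nu n k h.
Proof.
elim: n k g h => [//|n IH] k g h g0 gh /=.
apply: ler_lp2; rewrite ?g0 ?gh//.
by apply: ler_lp2 => //; apply: IH => t tn; rewrite ?g0 ?gh.
Qed.

Lemma tree_normZ n k c g : 0 <= c -> (forall t, 0 <= g t) ->
  nu n k (fun t => c * g t) = c * nu n k g.
Proof.
move=> c0; elim: n k g => [|n IH] k g g0 /=; first by rewrite mulr0.
by rewrite !IH// !lp2Z.
Qed.

Lemma tree_norm0 n k g : (forall t, g t = 0) -> nu n k g = 0.
Proof.
move=> g0; rewrite (@eq_tree_norm _ _ _ (fun t => 0 * g t)) ?tree_normZ ?mul0r//.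
  by move=> t; rewrite g0 lexx.
by move=> t; rewrite g0 mul0r.
Qed.

Lemma tree_norm_le_depth n m k g : (forall t, 0 <= g t) -> (n <= m)%N ->
  nu n k g <= nu m k g.
Proof.
elim: n m k g => [|n IH] [|m] k g g0 nm /=; rewrite ?lp2_ge0//.
by apply: ler_lp2 => //; apply: ler_lp2 => //; apply: IH.
Qed.

Lemma tree_norm_ge_coord n k g t : (forall t, 0 <= g t) -> (size t < n)%N ->
  g t <= nu n k g.
Proof.
elim: n k g t => [//|n IH] k g [|b t] g0 /= tn; first exact: lp2_ge_l.
apply: le_trans (lp2_ge_r (qq0 k) _ _) => //.
have h c : g (c :: t) <= nu n k.+1 (fun t => g (c :: t)) by apply: (IH k.+1 (fun t => g (c :: t))).
case: b; apply: le_trans (h _) _; [exact: lp2_ge_r | exact: lp2_ge_l].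
Qed.

Lemma tree_norm_support n m k g : (forall t, 0 <= g t) ->
  (forall t, (m <= size t)%N -> g t = 0) -> nu n k g <= nu m k g.
Proof.
elim: n m k g => [//|n IH] [|m] k g g0 gm.
  by rewrite (@tree_norm0 n.+1)// => t; rewrite gm.
by apply: ler_lp2 => //; apply: ler_lp2 => //; apply: IH => // t mt; rewrite gm.
Qed.

Lemma tree_norm_convex n k p g h : 0 < p ->
  (forall k, p <= pp k) -> (forall k, p <= qq k) ->
  (forall t, 0 <= g t) -> (forall t, 0 <= h t) ->
  nu n k (fun t => lp2 p (g t) (h t)) <= lp2 p (nu n k g) (nu n k h).
Proof.
move=> p0 ppp pqq; elim: n k g h => [|n IH] k g h g0 h0 /=; first by rewrite lp2r0.
apply: le_trans (lp2_swap _ _ _ _ _ _) => //.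
apply: ler_lp2 => //; apply: le_trans (lp2_swap _ _ _ _ _ _) => //.
by apply: ler_lp2 => //; apply: IH.
Qed.

Lemma tree_norm_concave n k q g h :
  (forall k, pp k <= q) -> (forall k, qq k <= q) ->
  (forall t, 0 <= g t) -> (forall t, 0 <= h t) ->
  lp2 q (nu n k g) (nu n k h) <= nu n k (fun t => lp2 q (g t) (h t)).
Proof.
move=> ppq qqq; have q0 : 0 < q by exact: lt_le_trans (pp0 0) (ppq 0%N).
elim: n k g h => [|n IH] k g h g0 h0 /=; first by rewrite lp2r0.
apply: le_trans (lp2_swap _ _ _ _ _ _) _ => //.
apply: ler_lp2 => //; apply: le_trans (lp2_swap _ _ _ _ _ _) _ => //.
by apply: ler_lp2 => //; apply: IH.
Qed.

Lemma tree_normD n k g h : (forall t, 0 <= g t) -> (forall t, 0 <= h t) ->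
  nu n k (fun t => g t + h t) <= nu n k g + nu n k h.
Proof.
move=> g0 h0; have E a b : 0 <= a -> 0 <= b -> lp2 1 a b = a + b :> R.
  by move=> a0 b0; rewrite lp2_def invr1 !powRr1// addr_ge0.
rewrite -E//; apply: le_trans (tree_norm_convex _ _ _ _ _ _ _) => //.
by rewrite (@eq_tree_norm _ _ _ (fun t => lp2 1 (g t) (h t)))// => t; rewrite E.
Qed.

Lemma tree_norm_two_point p q : 1 < p -> p <= 2 -> 2 <= q ->
  (forall k, p <= pp k) -> (forall k, p <= qq k) ->
  (forall k, pp k <= q) -> (forall k, qq k <= q) ->
  exists2 c : R, 0 < c & forall n k (x y u v : seq bool -> R),
    (forall t, diagonals (x t) (y t) (u t) (v t)) ->
    lp2 q (nu n k x) (c^-1 * nu n k y) <= mean2 2 (nu n k u) (nu n k v) /\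
    mean2 2 (nu n k u) (nu n k v) <= lp2 p (nu n k x) (c * nu n k y).
Proof.
move=> p1 p2 q2 ppp pqq ppq qqq.
have p0 : 0 < p by exact: lt_trans p1.
have q0 : 0 < q by exact: lt_le_trans q2.
have [c1 c10 h1] := diagonals_convex p1 p2 q2.
have [c2 c20 h2] := diagonals_smooth p1 p2 q2.
have c0 : 0 < c1^-1 + c2 by rewrite addr_gt0// invr_gt0.
exists (c1^-1 + c2) => // n k x y u v d.
have x0 t : 0 <= x t by have [[]] := d t.
have y0 t : 0 <= y t by have [[]] := d t.
have u0 t : 0 <= u t by have [[]] := d t.
have v0 t : 0 <= v t by have [[]] := d t.
have w r : 0 <= 2^-1 `^ r :> R by exact: powR_ge0.
have Z0 (c : R) g t : 0 <= c -> (forall t, 0 <= g t) -> 0 <= c * g t by move=> *; exact: mulr_ge0.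
have [c10' c20'] := (ltW c10, ltW c20).
split.
  apply: (@le_trans _ _ (lp2 q (nu n k x) (c1 * nu n k y))).
    apply: ler_lp2 => //; first by rewrite mulr_ge0// invr_ge0 ltW.
    rewrite ler_wpM2r// invf_ple ?posrE// lerDl//.
  apply: (@le_trans _ _ (mean2 p (nu n k u) (nu n k v))); last first.
    exact: ler_mean2_exponent.
  rewrite mean2_lp2// -!tree_normZ//.
  apply: le_trans (tree_norm_concave _ _ _ _ _ _) _ => //; first by move=> t; exact: Z0.
  apply: le_trans (tree_norm_convex _ _ _ _ _ _ _) => //; try by move=> t; exact: Z0.
  apply: ler_tree_norm => t _; first exact: lp2_ge0.
  by rewrite -mean2_lp2//; apply: h1.
apply: (@le_trans _ _ (lp2 p (nu n k x) (c2 * nu n k y))); last first.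
  apply: ler_lp2 => //; first by rewrite mulr_ge0.
  by rewrite ler_wpM2r// lerDr invr_ge0.
apply: (@le_trans _ _ (mean2 q (nu n k u) (nu n k v))); first exact: ler_mean2_exponent.
rewrite mean2_lp2// -!tree_normZ//.
apply: le_trans (tree_norm_concave _ _ _ _ _ _) _ => //; try by move=> t; exact: Z0.
apply: le_trans (tree_norm_convex _ _ _ _ _ _ _) => //; try by move=> t; exact: Z0.
apply: ler_tree_norm => t _; first exact: lp2_ge0.
by rewrite -mean2_lp2//; apply: h2.
Qed.

Lemma tree_norm_branch_le q n k s : 0 < q ->
  (forall j, (j < k + size s)%N -> q <= qq j) ->
  nu n k (fun t => (prefix t s)%:R) <= (size s).+1%:R `^ q^-1.
Proof.
move=> q0; elim: n k s => [|n IH] k s qs; first exact: powR_ge0.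
rewrite tree_normS prefix0s; case: s qs => [|b s] qs.
  have Z c : nu n k.+1 (fun t => (prefix (c :: t) [::])%:R) = 0 by exact: tree_norm0.
  by rewrite !(Z true) !lp2r0// powR1.
have zero c : c != b -> nu n k.+1 (fun t => (prefix (c :: t) (b :: s))%:R) = 0.
  by move=> cb; rewrite tree_norm0// => t; rewrite prefix_cons (negbTE cb).
have same : nu n k.+1 (fun t => (prefix (b :: t) (b :: s))%:R) <= (size s).+1%:R `^ q^-1.
  rewrite (@eq_tree_norm _ _ _ (fun t => (prefix t s)%:R)).
    by apply: IH => j js; apply: qs; rewrite /= addnS -addSn.
  by move=> t; rewrite prefix_cons eqxx.
apply: (@le_trans _ _ (lp2 (qq k) 1 ((size s).+1%:R `^ q^-1))).
  apply: ler_lp2 => //.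
  case: b zero same {qs} => zero same; first by rewrite zero// lp20r.
  by rewrite [X in lp2 _ _ X]zero// lp2r0.
apply: le_trans (ler_lp2_exponent q0 (qs k _) _ _) _; rewrite ?powR_ge0//.
  by rewrite /= addnS ltnS leq_addr.
by rewrite lp2_def powR1 powRVK// -[X in X + _]/(1%:R) -natrD add1n.
Qed.

Definition sibling (s : seq bool) (j : nat) := rcons (take j s) (~~ nth false s j).

Lemma tree_norm_siblings_ge p n k s g : 0 < p -> (forall t, 0 <= g t) ->
  (forall j, (j < k + size s)%N -> pp j <= p) -> (size s < n)%N ->
  (\sum_(j < size s) g (sibling s j) `^ p) `^ p^-1 <= nu n k g.
Proof.
move=> p0; elim: s n k g => [|b s IH] [//|n] k g g0 ps sn /=.
  by rewrite big_ord0 powR0 ?invr_eq0 ?gt_eqF.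
apply: le_trans (lp2_ge_r (qq0 k) _ _) => //.
apply: le_trans (ler_lp2_exponent (pp0 k) (ps k _) _ _) => //; last first.
  by rewrite /= addnS ltnS leq_addr.
have n0 : (0 < n)%N by move: sn; rewrite /= ltnS; apply: leq_ltn_trans.
have same : (\sum_(j < size s) g (b :: sibling s j) `^ p) `^ p^-1 <= nu n k.+1 (fun t => g (b :: t)).
  apply: (IH n k.+1 (fun t => g (b :: t))) => // j js; apply: ps.
  by rewrite /= addnS -addSn.
have other : g [:: ~~ b] <= nu n k.+1 (fun t => g (~~ b :: t)).
  exact: (@tree_norm_ge_coord n k.+1 (fun t => g (~~ b :: t)) [::]).
apply: (@le_trans _ _ (lp2 p (nu n k.+1 (fun t => g (b :: t))) (nu n k.+1 (fun t => g (~~ b :: t))))).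
  rewrite big_ord_recl lp2_def ler_powR2r ?invr_ge0 ?(ltW p0)//.
    by rewrite addr_ge0 ?powR_ge0// sumr_ge0// => *; exact: powR_ge0.
  rewrite [leRHS]addrC; apply: lerD; first by apply: ler_powR2r; rewrite ?(ltW p0).
  by rewrite -[leLHS](powRVK p0) ?sum_powR_ge0//; apply: ler_powR2r; rewrite ?(ltW p0) ?powR_ge0.
by case: (b) => /=; rewrite // lp2C.
Qed.

End TreeNorm.

Section ChangeParameters.
Context {R : realType} (pp qq pp' qq' : nat -> R) (K : nat).
Hypothesis pp1 : forall k, 1 <= pp k.
Hypothesis qq1 : forall k, 1 <= qq k.
Hypothesis pp1' : forall k, 1 <= pp' k.
Hypothesis qq1' : forall k, 1 <= qq' k.
Hypothesis ppE : forall k, (K <= k)%N -> pp' k = pp k.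
Hypothesis qqE : forall k, (K <= k)%N -> qq' k = qq k.

Lemma tree_norm_eq_tail n k g : (K <= k)%N ->
  tree_norm pp' qq' n k g = tree_norm pp qq n k g.
Proof.
elim: n k g => [//|n IH] k g Kk /=.
by rewrite !IH ?(leq_trans Kk)// ppE// qqE.
Qed.

(* Changing one exponent costs a factor 2, so one level of the tree costs 4. *)
Lemma tree_norm_change_head n k g : (forall t, 0 <= g t) ->
  tree_norm pp' qq' n k g <= 4 ^+ (K - k) * tree_norm pp qq n k g.
Proof.
elim: n k g => [|n IH] k g g0; first by rewrite mulr0.
have [Kk|kK] := leqP K k.
  by rewrite tree_norm_eq_tail// (eqP Kk) expr0 mul1r.
rewrite -(subnSK kK) exprS /=.
set c : R := 4 ^+ (K - k.+1).
have c1 : 1 <= c by rewrite exprn_ege1// ler1n.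
have := IH k.+1 (fun t => g (true :: t)) (fun=> g0 _).
have := IH k.+1 (fun t => g (false :: t)) (fun=> g0 _).
have := tree_norm_ge0 pp qq n k.+1 (fun t => g (true :: t)).
have := tree_norm_ge0 pp qq n k.+1 (fun t => g (false :: t)).
have := tree_norm_ge0 pp' qq' n k.+1 (fun t => g (true :: t)).
have := tree_norm_ge0 pp' qq' n k.+1 (fun t => g (false :: t)).
rewrite -/c; move: (tree_norm _ _ _ _ _) => a0; move: (tree_norm _ _ _ _ _) => a1.
move: (tree_norm _ _ _ _ _) => b0; move: (tree_norm _ _ _ _ _) => b1.
move=> a00 a10 b00 b10 h0 h1.
have /= A := lp2_ge0 (pp' k) a0 a1.
have := lp2_le_add (qq1' k) (g0 [::]) A.
have := lp2_le_add (pp1' k) a00 a10.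
have p0 : 0 < pp k by exact: lt_le_trans (pp1 k).
have q0 : 0 < qq k by exact: lt_le_trans (qq1 k).
have := lp2_ge_add p0 b00 b10.
have := lp2_ge_add q0 (g0 [::]) (lp2_ge0 (pp k) b0 b1).
have := lp2_ge0 (pp k) b0 b1.
move: (lp2 (pp' k) a0 a1) (lp2 (pp k) b0 b1) => x y.
move: (g [::]) (g0 [::]) => z z0.
move: (lp2 _ _ x) (lp2 _ _ y) => X Y y0 h2 h3 h4 h5.
have : c * (b0 + b1) <= c * (2 * y) by rewrite ler_wpM2l//; lra.
have : c * (z + y) <= c * (2 * Y) by rewrite ler_wpM2l//; lra.
have : z <= c * z by rewrite ler_peMl.
have : 0 <= c * z by rewrite mulr_ge0//; lra.
lra.
Qed.

End ChangeParameters.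

(** * Real and complex scalars *)

Lemma Re_normc (R : realType) (z : R[i]) :
  complex.Re `|z| = Num.sqrt (complex.Re z ^+ 2 + complex.Im z ^+ 2).
Proof. by rewrite normc_def. Qed.

Lemma normr_Re_le (R : realType) (z : R[i]) : `|complex.Re z| <= complex.Re `|z|.
Proof.
by rewrite Re_normc -sqrtr_sqr ler_sqrt ?lerDl ?sqr_ge0// addr_ge0 ?sqr_ge0.
Qed.

Lemma normr_Im_le (R : realType) (z : R[i]) : `|complex.Im z| <= complex.Re `|z|.
Proof.
by rewrite Re_normc -sqrtr_sqr ler_sqrt ?lerDr ?sqr_ge0// addr_ge0 ?sqr_ge0.
Qed.

Lemma Re_normc_le (R : realType) (z : R[i]) :
  complex.Re `|z| <= `|complex.Re z| + `|complex.Im z|.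
Proof.
rewrite Re_normc -[leRHS]ger0_norm ?addr_ge0// -sqrtr_sqr ler_sqrt ?sqr_ge0//.
rewrite -[complex.Re z ^+ 2]real_normK ?num_real//.
rewrite -[complex.Im z ^+ 2]real_normK ?num_real//.
by rewrite sqrrD lerD2r lerDl mulrn_wge0// mulr_ge0.
Qed.

Section Scalars.
Context {R : realType} {F : scalar_kind}.
Local Notation K := (scalars R F).

Definition real_scalar : R -> K :=
  match F return R -> scalars R F with
  | RealScalars => fun a => a
  | ComplexScalars => fun a => real_complex R a
  end.

Lemma re_real_scalar x : re_scalar (real_scalar x) = x.
Proof. by rewrite /re_scalar /real_scalar; case: F. Qed.

Lemma ler_real_scalar x y : (real_scalar x <= real_scalar y) = (x <= y).
Proof. by rewrite /real_scalar; case: F => //=; exact: lecR. Qed.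

Lemma ltr_real_scalar x y : (real_scalar x < real_scalar y) = (x < y).
Proof. by rewrite /real_scalar; case: F => //=; exact: ltcR. Qed.

Lemma real_scalarD x y : real_scalar (x + y) = real_scalar x + real_scalar y.
Proof. by rewrite /real_scalar; case: F => //=; exact: rmorphD. Qed.

Lemma real_scalarM x y : real_scalar (x * y) = real_scalar x * real_scalar y.
Proof. by rewrite /real_scalar; case: F => //=; exact: rmorphM. Qed.

Lemma real_scalar0 : real_scalar 0 = 0.
Proof. by rewrite /real_scalar; case: F. Qed.

Lemma norm_real_scalar (a : K) : `|a| = real_scalar (abs_scalar a).
Proof.
move: a; rewrite /abs_scalar /re_scalar /real_scalar; by case: F => //= a; rewrite normc_def.
Qed.

Lemma real_scalar_gt0 (e : K) : 0 < e -> exists2 d : R, 0 < d & e = real_scalar d.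
Proof.
move: e; rewrite /real_scalar; case: F => /= [e e0|[a b]]; first by exists e.
by rewrite ltcE/= => /andP[/eqP -> a0]; exists a.
Qed.

Lemma abs_scalar_ge0 (a : K) : 0 <= abs_scalar a.
Proof. by rewrite -ler_real_scalar -norm_real_scalar real_scalar0. Qed.

Lemma abs_scalarD (a b : K) : abs_scalar (a + b) <= abs_scalar a + abs_scalar b.
Proof.
by rewrite -ler_real_scalar real_scalarD -!norm_real_scalar ler_normD.
Qed.

Lemma real_scalar_inj : injective real_scalar.
Proof. by move=> x y /(congr1 (@re_scalar R F)); rewrite !re_real_scalar. Qed.

Lemma abs_scalarM (a b : K) : abs_scalar (a * b) = abs_scalar a * abs_scalar b.
Proof.
by apply: real_scalar_inj; rewrite real_scalarM -!norm_real_scalar normrM.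
Qed.

Lemma abs_scalar_eq0 (a : K) : abs_scalar a = 0 -> a = 0.
Proof.
by move=> a0; apply/normr0_eq0; rewrite norm_real_scalar a0 real_scalar0.
Qed.

Lemma abs_scalar0 : abs_scalar (0 : K) = 0.
Proof. by apply: real_scalar_inj; rewrite -norm_real_scalar normr0 real_scalar0. Qed.

Lemma abs_scalarN (a : K) : abs_scalar (- a) = abs_scalar a.
Proof. by apply: real_scalar_inj; rewrite -!norm_real_scalar normrN. Qed.

Lemma real_scalar_nat n : real_scalar n%:R = n%:R.
Proof. by rewrite /real_scalar; case: F => //=; rewrite rmorph_nat. Qed.

Lemma abs_scalar_nat n : abs_scalar (n%:R : K) = n%:R.
Proof.
by apply: real_scalar_inj; rewrite -norm_real_scalar real_scalar_nat normr_nat.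
Qed.

Lemma abs_scalar_natV n : abs_scalar (n%:R^-1 : K) = n%:R^-1.
Proof.
have [->|n0] := eqVneq n 0%N; first by rewrite !invr0 abs_scalar0.
have nR : n%:R != 0 :> R by rewrite pnatr_eq0.
apply: (mulfI nR); rewrite mulfV// -[X in X * _](abs_scalar_nat n) -abs_scalarM.
by rewrite mulfV ?pnatr_eq0// (abs_scalar_nat 1).
Qed.

Lemma abs_scalar_sign (b : bool) : abs_scalar ((-1) ^+ b : K) = 1.
Proof. by case: b; rewrite ?expr1 ?abs_scalarN (abs_scalar_nat 1). Qed.

Lemma abs_scalar_parallelogram (a b : K) :
  abs_scalar (a + b) ^+ 2 + abs_scalar (a - b) ^+ 2 =
  2 * (abs_scalar a ^+ 2 + abs_scalar b ^+ 2).
Proof.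
move: a b; rewrite /abs_scalar /re_scalar; case: F => [a b|a b].
  by rewrite !real_normK ?num_real//; ring.
rewrite !Re_normc !sqr_sqrtr ?addr_ge0 ?sqr_ge0//.
by case: a b => [a1 a2] [b1 b2] /=; ring.
Qed.

Lemma abs_scalar_diagonals (a b : K) :
  diagonals (abs_scalar a) (abs_scalar b) (abs_scalar (a + b)) (abs_scalar (a - b)).
Proof.
split; split; rewrite ?abs_scalar_ge0 ?abs_scalar_parallelogram//.
- rewrite -(abs_scalar_nat 2) -abs_scalarM.
  have -> : 2 * a = (a + b) + (a - b) by ring.
  exact: abs_scalarD.
- rewrite -(abs_scalar_nat 2) -abs_scalarM.
  have -> : 2 * b = (a + b) + - (a - b) by ring.
  by rewrite (le_trans (abs_scalarD _ _))// abs_scalarN.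
- exact: abs_scalarD.
- by rewrite (le_trans (abs_scalarD _ _))// abs_scalarN.
Qed.

End Scalars.

Lemma real_limit (R : realType) (T : Type) (G : set_system T) (phi : T -> R) :
  ProperFilter G ->
  (forall e : R, 0 < e -> exists x0, G [set x | `|phi x - phi x0| <= e]) ->
  exists l, forall e : R, 0 < e -> G [set x | `|phi x - l| <= e].
Proof.
move=> GG h.
have c : cauchy (phi @ G).
  apply/cauchyP => e e0; have e20 : 0 < e / 2 by rewrite divr_gt0.
  have [x0 hx] := h _ e20; exists (phi x0).
  rewrite /fmap/= /nbhs/=; apply: filterS hx => x /= hx; rewrite /ball/= distrC.
  by rewrite (le_lt_trans hx)// gtr_pMr// invf_lt1// ltr1n.
have := R_complete (fmap_proper_filter _ GG) c.
move=> /cvg_ex => -[l /cvgrPdist_le hl].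
by exists l => e /hl; apply: filterS => x /=; rewrite distrC.
Qed.

Lemma complex_limit (R : realType) (T : Type) (G : set_system T) (phi : T -> R[i]) :
  ProperFilter G ->
  (forall e : R, 0 < e -> exists x0, G [set x | complex.Re `|phi x - phi x0| <= e]) ->
  exists l, forall e : R, 0 < e -> G [set x | complex.Re `|phi x - l| <= e].
Proof.
move=> GG h.
have [|l1 h1] := @real_limit _ _ _ (fun x => complex.Re (phi x)) GG.
  move=> e /h[x0 hx]; exists x0; apply: filterS hx => x hx.
  by apply: le_trans hx; rewrite -raddfB; exact: normr_Re_le.
have [|l2 h2] := @real_limit _ _ _ (fun x => complex.Im (phi x)) GG.
  move=> e /h[x0 hx]; exists x0; apply: filterS hx => x hx.
  by apply: le_trans hx; rewrite -raddfB; exact: normr_Im_le.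
exists (Complex l1 l2) => e e0; have e20 : 0 < e / 2 by rewrite divr_gt0.
apply: filterS (filterI (h1 _ e20) (h2 _ e20)) => x [ha hb].
apply: le_trans (Re_normc_le _) _; rewrite [leRHS](splitr e); apply: lerD.
  by move: ha; rewrite /mkset; case: (phi x).
by move: hb; rewrite /mkset; case: (phi x).
Qed.

Lemma scalar_limit (R : realType) (F : scalar_kind) (T : Type) (G : set_system T)
    (phi : T -> scalars R F) :
  ProperFilter G ->
  (forall e : R, 0 < e -> exists x0, G [set x | abs_scalar (phi x - phi x0) <= e]) ->
  exists l, forall e : R, 0 < e -> G [set x | abs_scalar (phi x - l) <= e].
Proof.
move=> GG; move: phi; rewrite /abs_scalar /re_scalar; case: F => phi h.
  exact: (@real_limit _ _ _ phi GG h).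
exact: complex_limit h.
Qed.

(** * Norms on the infinite tree *)

Record tree_params (R : realType) := TreeParams {
  tp : nat -> R;
  tq : nat -> R;
  tp_ge1 : forall k, 1 <= tp k;
  tq_ge1 : forall k, 1 <= tq k }.

Section TreeSup.
Context {R : realType} {F : scalar_kind}.
Local Notation K := (scalars R F).
Implicit Types (P : tree_params R) (f g : seq bool -> K).

Definition trunc_norm P (n : nat) f : R :=
  tree_norm (tp P) (tq P) n 0 (fun t => abs_scalar (f t)).

Definition tree_bounded P f := exists M, forall n, trunc_norm P n f <= M.

Lemma trunc_norm_ge0 P n f : 0 <= trunc_norm P n f.
Proof. exact: tree_norm_ge0. Qed.

Lemma trunc_norm_mono P m n f : (m <= n)%N -> trunc_norm P m f <= trunc_norm P n f.
Proof.
apply: tree_norm_le_depth => [k|k|t]; [exact: tp_ge1|exact: tq_ge1|].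
exact: abs_scalar_ge0.
Qed.

Lemma trunc_normD P n f g : trunc_norm P n (f + g) <= trunc_norm P n f + trunc_norm P n g.
Proof.
have p1 := @tp_ge1 _ P; have q1 := @tq_ge1 _ P.
apply: le_trans (tree_normD p1 q1 n 0 _ _) => [|t|t]; last 2 first.
- exact: abs_scalar_ge0.
- exact: abs_scalar_ge0.
by apply: ler_tree_norm => // t _; [exact: abs_scalar_ge0|exact: abs_scalarD].
Qed.

Lemma trunc_normZ P n (a : K) f : trunc_norm P n (a *: f) = abs_scalar a * trunc_norm P n f.
Proof.
have p1 := @tp_ge1 _ P; have q1 := @tq_ge1 _ P.
rewrite -tree_normZ ?abs_scalar_ge0// => [|t]; last exact: abs_scalar_ge0.
by apply: eq_tree_norm => t; rewrite -abs_scalarM.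
Qed.

Lemma trunc_norm_coord P n f t : (size t < n)%N -> abs_scalar (f t) <= trunc_norm P n f.
Proof.
have p1 := @tp_ge1 _ P; have q1 := @tq_ge1 _ P.
apply: (tree_norm_ge_coord p1 q1 0 (g := fun t => abs_scalar (f t))) => u.
exact: abs_scalar_ge0.
Qed.

End TreeSup.

HB.lock Definition tnorm (R : realType) (F : scalar_kind) (P : tree_params R)
  (f : seq bool -> scalars R F) : R := sup (range (fun n => trunc_norm P n f)).

Section TNorm.
Context {R : realType} {F : scalar_kind}.
Local Notation K := (scalars R F).
Implicit Types (P : tree_params R) (f g : seq bool -> K).

Lemma trunc_norm_le P n f : tree_bounded P f -> trunc_norm P n f <= tnorm P f.
Proof.
move=> [M fM]; rewrite tnorm.unlock; apply: ub_le_sup; last by exists n.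
by exists M => _ [k _ <-].
Qed.

Lemma tnorm_le P f M : (forall n, trunc_norm P n f <= M) -> tnorm P f <= M.
Proof.
move=> fM; rewrite tnorm.unlock; apply: ge_sup; first by exists (trunc_norm P 0 f), 0%N.
by move=> _ [k _ <-].
Qed.

Lemma tnorm_ge0 P f : tree_bounded P f -> 0 <= tnorm P f.
Proof. by move=> bf; apply: le_trans (trunc_norm_le 0 bf); exact: trunc_norm_ge0. Qed.

Lemma tree_boundedD P f g : tree_bounded P f -> tree_bounded P g -> tree_bounded P (f + g).
Proof.
move=> bf bg; exists (tnorm P f + tnorm P g) => n.
by apply: le_trans (trunc_normD _ _ _ _) _; apply: lerD; exact: trunc_norm_le.
Qed.

Lemma tree_boundedZ P a f : tree_bounded P f -> tree_bounded P (a *: f).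
Proof.
move=> bf; exists (abs_scalar a * tnorm P f) => n.
by rewrite trunc_normZ; apply: ler_wpM2l; [exact: abs_scalar_ge0|exact: trunc_norm_le].
Qed.

Lemma tree_bounded0 P : tree_bounded P (0 : seq bool -> K).
Proof.
by exists 0 => n; rewrite -(scale0r 0) trunc_normZ abs_scalar0 mul0r.
Qed.

Lemma tree_boundedB P f g : tree_bounded P f -> tree_bounded P g -> tree_bounded P (f - g).
Proof.
by move=> bf bg; rewrite -scaleN1r; apply: tree_boundedD => //; exact: tree_boundedZ.
Qed.

Lemma tnormD P f g : tree_bounded P f -> tree_bounded P g ->
  tnorm P (f + g) <= tnorm P f + tnorm P g.
Proof.
move=> bf bg; apply: tnorm_le => n.
by apply: le_trans (trunc_normD _ _ _ _) _; apply: lerD; exact: trunc_norm_le.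
Qed.

Lemma tnormZ P a f : tree_bounded P f -> tnorm P (a *: f) = abs_scalar a * tnorm P f.
Proof.
have h b g : tree_bounded P g -> tnorm P (b *: g) <= abs_scalar b * tnorm P g.
  move=> bg; apply: tnorm_le => n; rewrite trunc_normZ.
  by apply: ler_wpM2l; [exact: abs_scalar_ge0|exact: trunc_norm_le].
move=> bf; apply: le_anti; rewrite h//=.
have [->|a0] := eqVneq a 0.
  by rewrite abs_scalar0 mul0r tnorm_ge0//; exact: tree_boundedZ.
have := h a^-1 _ (tree_boundedZ a bf); rewrite scalerA mulVf// scale1r => hf.
have := ler_wpM2l (abs_scalar_ge0 a) hf.
by rewrite mulrA -abs_scalarM mulfV// (abs_scalar_nat 1) mul1r.
Qed.

Lemma abs_scalar_le_tnorm P f t : tree_bounded P f -> abs_scalar (f t) <= tnorm P f.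
Proof.
move=> bf; apply: le_trans (trunc_norm_le (size t).+1 bf).
exact: trunc_norm_coord.
Qed.

Lemma tnorm_eq0 P f : tree_bounded P f -> tnorm P f = 0 -> f = 0.
Proof.
move=> bf f0; apply/funext => t; apply: abs_scalar_eq0; apply: le_anti.
by rewrite abs_scalar_ge0 andbT -f0 abs_scalar_le_tnorm.
Qed.

Lemma tree_bounded_finite P m f : (forall t, (m <= size t)%N -> f t = 0) -> tree_bounded P f.
Proof.
move=> fm; exists (trunc_norm P m f) => n.
apply: tree_norm_support; [exact: tp_ge1|exact: tq_ge1| |].
  by move=> t; exact: abs_scalar_ge0.
by move=> t mt; rewrite fm// abs_scalar0.
Qed.

Lemma tnorm_finite P m f : (forall t, (m <= size t)%N -> f t = 0) ->
  tnorm P f = trunc_norm P m f.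
Proof.
move=> fm; apply: le_anti; rewrite trunc_norm_le ?andbT; last first.
  exact: tree_bounded_finite fm.
apply: tnorm_le => n.
apply: tree_norm_support; [exact: tp_ge1|exact: tq_ge1| |].
  by move=> t; exact: abs_scalar_ge0.
by move=> t mt; rewrite fm// abs_scalar0.
Qed.

End TNorm.

Section LimitOfTwoSups.
Context {R : realType}.

Lemma lp2_sup_le q (a b : nat -> R) A B M : 0 < q ->
  (forall n, 0 <= a n) -> (forall n, 0 <= b n) ->
  {homo a : m n / (m <= n)%N >-> m <= n} -> {homo b : m n / (m <= n)%N >-> m <= n} ->
  0 <= A -> 0 <= B -> 0 <= M ->
  (forall M', (forall n, a n <= M') -> A <= M') ->
  (forall M', (forall n, b n <= M') -> B <= M') ->
  (forall n, lp2 q (a n) (b n) <= M) -> lp2 q A B <= M.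
Proof.
move=> q0 a0 b0 am bm A0 B0 M0 supA supB h.
have q0' := ltW q0.
have le1 n m : a n `^ q + b m `^ q <= M `^ q.
  have := ler_powR2r q0' (lp2_ge0 _ _ _) (h (maxn n m)); rewrite lp2_powR//.
  by apply: le_trans; apply: lerD; apply: ler_powR2r => //;
    [exact/am/leq_maxl | exact/bm/leq_maxr].
have le2 m : A `^ q + b m `^ q <= M `^ q.
  have MB : 0 <= M `^ q - b m `^ q.
    by rewrite subr_ge0 (le_trans _ (le1 0%N m))// lerDr powR_ge0.
  rewrite -lerBrDr ler_powRV//; apply: supA => n.
  by rewrite -ler_powRV// lerBrDr.
have MA : 0 <= M `^ q - A `^ q.
  by rewrite subr_ge0 (le_trans _ (le2 0%N))// lerDl powR_ge0.
rewrite lp2_def ler_powRV ?invr_gt0 ?invrK ?addr_ge0 ?powR_ge0//.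
rewrite -lerBrDl ler_powRV//; apply: supB => n.
by rewrite -ler_powRV// lerBrDl.
Qed.

End LimitOfTwoSups.

Section TNormTwoPoint.
Context {R : realType} {F : scalar_kind} (P : tree_params R).
Local Notation K := (scalars R F).
Implicit Types (f g : seq bool -> K).

Lemma scaled_tnorm_lub c f M : 0 < c -> tree_bounded P f ->
  (forall n, c * trunc_norm P n f <= M) -> c * tnorm P f <= M.
Proof.
move=> c0 bf h; rewrite mulrC -ler_pdivlMr//; apply: tnorm_le => n.
by rewrite ler_pdivlMr// mulrC.
Qed.

Lemma tnorm_two_point p q : 1 < p -> p <= 2 -> 2 <= q ->
  (forall k, p <= tp P k <= q) -> (forall k, p <= tq P k <= q) ->
  exists2 c : R, 0 < c & forall f g : seq bool -> K,
    tree_bounded P f -> tree_bounded P g ->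
    lp2 q (tnorm P f) (c^-1 * tnorm P g) <= mean2 2 (tnorm P (f + g)) (tnorm P (f - g)) /\
    mean2 2 (tnorm P (f + g)) (tnorm P (f - g)) <= lp2 p (tnorm P f) (c * tnorm P g).
Proof.
move=> p1 p2 q2 hp hq.
have p0 : 0 < p by exact: lt_trans p1.
have q0 : 0 < q by exact: lt_le_trans q2.
have [] := tree_norm_two_point (@tp_ge1 _ P) (@tq_ge1 _ P) p1 p2 q2.
- by move=> k; have /andP[] := hp k.
- by move=> k; have /andP[] := hq k.
- by move=> k; have /andP[] := hp k.
- by move=> k; have /andP[] := hq k.
move=> c c0 h; exists c => // f g bf bg; have c0' := ltW c0.
have cv0 : 0 < c^-1 by rewrite invr_gt0.
have bD := tree_boundedD bf bg; have bB := tree_boundedB bf bg.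
have d n := h n 0%N (fun t => abs_scalar (f t)) (fun t => abs_scalar (g t))
  (fun t => abs_scalar (f t + g t)) (fun t => abs_scalar (f t - g t))
  (fun t => abs_scalar_diagonals _ _).
have w0 : 0 < 2^-1 `^ 2^-1 :> R by rewrite powR_gt0// invr_gt0.
have Z0 (x y : R) : 0 < x -> 0 <= y -> 0 <= x * y by move=> /ltW *; exact: mulr_ge0.
have mono (x : R) u : 0 < x ->
    {homo (fun n => x * trunc_norm P n u) : m n / (m <= n)%N >-> m <= n}.
  by move=> x0 m n mn; rewrite ler_pM2l// trunc_norm_mono.
split.
  apply: (@lp2_sup_le _ q (fun n => trunc_norm P n f) (fun n => c^-1 * trunc_norm P n g)) => //.
  - by move=> n; exact: trunc_norm_ge0.
  - by move=> n; apply: Z0 => //; exact: trunc_norm_ge0.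
  - by move=> m n; exact: trunc_norm_mono.
  - exact: mono.
  - exact: tnorm_ge0.
  - by apply: Z0 => //; exact: tnorm_ge0.
  - exact: mean2_ge0.
  - by move=> M; exact: tnorm_le.
  - by move=> M; exact: scaled_tnorm_lub.
  move=> n; have [h1 _] := d n; apply: le_trans h1 _.
  rewrite !mean2_lp2 ?tnorm_ge0 ?trunc_norm_ge0//.
  by apply: ler_lp2; rewrite ?Z0 ?trunc_norm_ge0// ler_pM2l// trunc_norm_le.
rewrite mean2_lp2 ?tnorm_ge0//.
apply: (@lp2_sup_le _ 2 (fun n => 2^-1 `^ 2^-1 * trunc_norm P n (f + g))
                        (fun n => 2^-1 `^ 2^-1 * trunc_norm P n (f - g))) => //.
- by move=> n; apply: Z0 => //; exact: trunc_norm_ge0.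
- by move=> n; apply: Z0 => //; exact: trunc_norm_ge0.
- exact: mono.
- exact: mono.
- by apply: Z0 => //; exact: tnorm_ge0.
- by apply: Z0 => //; exact: tnorm_ge0.
- exact: lp2_ge0.
- by move=> M; exact: scaled_tnorm_lub.
- by move=> M; exact: scaled_tnorm_lub.
move=> n; have [_ h2] := d n.
rewrite -mean2_lp2 ?trunc_norm_ge0//; apply: le_trans h2 _.
by apply: ler_lp2; rewrite ?Z0 ?trunc_norm_ge0// ?ler_pM2l ?trunc_norm_le.
Qed.

End TNormTwoPoint.

(** * The Banach space of functions of finite tree norm *)

Definition tree_bounded_pred (R : realType) (F : scalar_kind) (P : tree_params R) :
  {pred seq bool -> scalars R F} := fun f => `[< tree_bounded P f >].

Arguments tree_bounded_pred {R} F P.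

Record tree_space (R : realType) (F : scalar_kind) (P : tree_params R) := TreeSpace {
  tree_val : seq bool -> scalars R F;
  tree_valP : tree_val \in tree_bounded_pred F P }.

Arguments tree_space {R} F P.

Section TreeSpace.
Context {R : realType} {F : scalar_kind} {P : tree_params R}.
Local Notation K := (scalars R F).
Local Notation X := (tree_space F P).

HB.instance Definition _ := [isSub for @tree_val R F P].
HB.instance Definition _ := [Choice of X by <:].

Lemma tree_bounded_submod : submod_closed (tree_bounded_pred F P).
Proof.
split; first by apply/asboolP; exact: tree_bounded0.
move=> a f g /asboolP bf /asboolP bg; apply/asboolP.
by apply: tree_boundedD => //; exact: tree_boundedZ.
Qed.

HB.instance Definition _ := GRing.isSubmodClosed.Build K (seq bool -> K)
  (tree_bounded_pred F P) tree_bounded_submod.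
HB.instance Definition _ := [SubChoice_isSubLmodule of X by <:].

Lemma tree_val_bounded (x : X) : tree_bounded P (tree_val x).
Proof. by apply/asboolP; exact: tree_valP. Qed.

Definition tree_space_norm (x : X) : K := real_scalar (tnorm P (tree_val x)).

Lemma tree_space_normD x y :
  tree_space_norm (x + y) <= tree_space_norm x + tree_space_norm y.
Proof.
rewrite -real_scalarD ler_real_scalar.
by apply: tnormD; exact: tree_val_bounded.
Qed.

Lemma tree_space_normZ (a : K) x : tree_space_norm (a *: x) = `|a| * tree_space_norm x.
Proof.
by rewrite norm_real_scalar -real_scalarM /tree_space_norm -(tnormZ _ (tree_val_bounded x)).
Qed.

Lemma tree_space_norm_eq0 x : tree_space_norm x = 0 -> x = 0.
Proof.
rewrite -real_scalar0 => /real_scalar_inj.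
by move=> /(tnorm_eq0 (tree_val_bounded x)) h; apply: val_inj.
Qed.

HB.instance Definition _ := Lmodule_isNormed.Build K X
  tree_space_normD tree_space_normZ tree_space_norm_eq0.

Lemma tree_space_normE (x : X) : `|x| = real_scalar (tnorm P (tree_val x)).
Proof. by []. Qed.

Lemma trunc_norm_small n (e : R) : 0 < e -> exists2 d : R, 0 < d &
  forall f : seq bool -> K, (forall t, (size t < n)%N -> abs_scalar (f t) <= d) ->
  trunc_norm P n f <= e.
Proof.
move=> e0; have p1 := @tp_ge1 _ P; have q1 := @tq_ge1 _ P.
pose N := tree_norm (tp P) (tq P) n 0 (fun=> 1).
have N0 : 0 <= N by exact: tree_norm_ge0.
have N1 : 0 < N + 1 by rewrite ltr_wpDl.
exists (e / (N + 1)); first by rewrite divr_gt0.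
move=> f fd; have d0 : 0 <= e / (N + 1) by rewrite divr_ge0// ltW.
apply: (@le_trans _ _ (e / (N + 1) * N)).
  rewrite -tree_normZ//; apply: ler_tree_norm => // t tn; first exact: abs_scalar_ge0.
  by rewrite mulr1; exact: fd.
by rewrite -mulrA ger_pMr// mulrC ler_pdivrMr// mul1r lerDl.
Qed.

Lemma tree_space_cauchy_cvg (G : set_system X) :
  ProperFilter G -> cauchy G -> cvg G.
Proof.
move=> GG /cauchyP cG.
have c e : 0 < e -> exists x0 : X, G [set x | tnorm P (tree_val (x - x0)) <= e].
  move=> e0; have : 0 < real_scalar e :> K by rewrite -real_scalar0 ltr_real_scalar.
  move=> /cG [x0 h]; exists x0; apply: filterS h => x.
  rewrite -ball_normE /ball_/= distrC tree_space_normE ltr_real_scalar.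
  exact: ltW.
have /choice[l hl] : forall t, exists l : K, forall e : R, 0 < e ->
    G [set x : X | abs_scalar (tree_val x t - l) <= e].
  move=> t; apply: (@scalar_limit _ _ _ _ (fun x : X => tree_val x t)) => e /c[x0 h].
  exists x0; apply: filterS h => x; apply: le_trans.
  exact: (abs_scalar_le_tnorm t (tree_val_bounded (x - x0))).
have near n : forall u (d : R), 0 < d ->
    G [set x : X | forall t, (size t < n)%N -> abs_scalar (l (u ++ t) - tree_val x (u ++ t)) <= d].
  elim: n => [|n IH] u d d0; first by apply: filterS filterT.
  apply: filterS (filterI (hl u d d0) (filterI (IH (rcons u false) d d0) (IH (rcons u true) d d0))).
  move=> x [h1 [h2 h3]] [|b t] /= tn; first by rewrite cats0 -abs_scalarN opprB.
  by rewrite -cat_rcons; case: b; [exact: h3|exact: h2].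
have close e x0 : 0 < e -> G [set x : X | tnorm P (tree_val (x - x0)) <= e] ->
    forall n, trunc_norm P n (l - tree_val x0) <= e.
  move=> e0 ge n; apply/ler_addgt0Pr => h h0.
  have [d d0 small] := trunc_norm_small n h0.
  have [x [hx1 hx2]] := filter_ex (filterI ge (near n [::] d d0)).
  have -> : l - tree_val x0 = (tree_val x - tree_val x0) + (l - tree_val x).
    by rewrite [RHS]addrC addrA subrK.
  apply: le_trans (trunc_normD _ _ _ _) _; apply: lerD; last exact: small.
  apply: le_trans hx1; exact: (trunc_norm_le n (tree_val_bounded (x - x0))).
have lb : l \in tree_bounded_pred F P.
  have [x0 h] := c 1 ltr01; apply/asboolP.
  have -> : l = (l - tree_val x0) + tree_val x0 by rewrite subrK.
  apply: tree_boundedD; last exact: tree_val_bounded.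
  by exists 1; exact: close.
apply/cvg_ex; exists (TreeSpace lb); apply/cvgrPdist_le => e.
move=> /real_scalar_gt0[d d0 ->]; have d20 : 0 < d / 2 by rewrite divr_gt0.
have [x0 h] := c _ d20; apply: filterS (h) => x hx.
rewrite tree_space_normE ler_real_scalar.
have -> : tree_val (TreeSpace lb - x) = (l - tree_val x0) - tree_val (x - x0).
  rewrite -[tree_val (x - x0)]/(tree_val x - tree_val x0) opprB addrA subrK.
  by [].
apply: tnorm_le => n; rewrite [leRHS](splitr d) -[- tree_val (x - x0)]scaleN1r.
apply: le_trans (trunc_normD _ _ _ _) _; apply: lerD; first exact: (close _ x0 d20 h n).
rewrite trunc_normZ abs_scalarN (abs_scalar_nat 1) mul1r.
apply: le_trans hx; exact: (trunc_norm_le n (tree_val_bounded (x - x0))).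
Qed.

HB.instance Definition _ := Uniform_isComplete.Build X tree_space_cauchy_cvg.

Lemma rnorm_tree_space (x : X) : rnorm x = tnorm P (tree_val x).
Proof. by rewrite /rnorm tree_space_normE re_real_scalar. Qed.

End TreeSpace.

Definition banach_tree_space (R : realType) (F : scalar_kind) (P : tree_params R) :
  completeNormedModType (scalars R F) := tree_space F P.

(** * Convexity and smoothness *)

Section PowerTypes.
Context {R : realType} {F : scalar_kind}.

Section Renorming.
Context (P : tree_params R) (K : nat).

Definition head2 (a : nat -> R) (k : nat) : R := if (k < K)%N then 2 else a k.

Lemma head2_ge1 a : (forall k, 1 <= a k) -> forall k, 1 <= head2 a k.
Proof. by move=> a1 k; rewrite /head2; case: ifP => // _; rewrite ler1n. Qed.

Definition renormed : tree_params R :=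
  TreeParams (head2_ge1 (@tp_ge1 _ P)) (head2_ge1 (@tq_ge1 _ P)).

Lemma head2_tail a k : (K <= k)%N -> head2 a k = a k.
Proof. by rewrite /head2 ltnNge => ->. Qed.

Lemma trunc_norm_renormed_le n (f : seq bool -> scalars R F) :
  trunc_norm renormed n f <= 4 ^+ K * trunc_norm P n f.
Proof.
rewrite -[X in 4 ^+ X]subn0.
apply: tree_norm_change_head => [k|k|k|k|k|k|t]; last exact: abs_scalar_ge0.
- exact: tp_ge1.
- exact: tq_ge1.
- exact: (@tp_ge1 _ renormed).
- exact: (@tq_ge1 _ renormed).
- exact: head2_tail.
- exact: head2_tail.
Qed.

Lemma trunc_norm_le_renormed n (f : seq bool -> scalars R F) :
  trunc_norm P n f <= 4 ^+ K * trunc_norm renormed n f.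
Proof.
rewrite -[X in 4 ^+ X]subn0.
apply: tree_norm_change_head => [k|k|k|k|k|k|t]; last exact: abs_scalar_ge0.
- exact: (@tp_ge1 _ renormed).
- exact: (@tq_ge1 _ renormed).
- exact: tp_ge1.
- exact: tq_ge1.
- by move=> kK; rewrite /= head2_tail.
- by move=> kK; rewrite /= head2_tail.
Qed.

Lemma tree_bounded_renormed (f : seq bool -> scalars R F) :
  tree_bounded P f -> tree_bounded renormed f.
Proof.
move=> [M fM]; exists (4 ^+ K * M) => n.
by apply: le_trans (trunc_norm_renormed_le n f) _; rewrite ler_pM2l ?exprn_gt0.
Qed.

Local Notation X := (banach_tree_space F P).

Definition renorm (x : X) : R := tnorm renormed (tree_val x).

Lemma renorm_bounded (x : X) : tree_bounded renormed (tree_val x).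
Proof. by apply: tree_bounded_renormed; exact: tree_val_bounded. Qed.

Lemma equivalent_renorm : equivalent_norm renorm.
Proof.
have K0 : 0 < 4 ^+ K :> R by rewrite exprn_gt0.
split.
- by move=> x y; apply: tnormD; exact: renorm_bounded.
- by move=> a x; exact: (tnormZ a (renorm_bounded x)).
- exists (4 ^+ K)^-1, (4 ^+ K); split; rewrite ?invr_gt0// => x.
  rewrite rnorm_tree_space; split.
    rewrite mulrC ler_pdivrMr// mulrC; apply: tnorm_le => n.
    apply: le_trans (trunc_norm_le_renormed n _) _; rewrite ler_pM2l//.
    by apply: trunc_norm_le; exact: renorm_bounded.
  apply: tnorm_le => n; apply: le_trans (trunc_norm_renormed_le n _) _.
  by rewrite ler_pM2l//; apply: trunc_norm_le; exact: tree_val_bounded.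
Qed.

Context (p q : R).
Hypotheses (p1 : 1 < p) (p2 : p <= 2) (q2 : 2 <= q).
Hypothesis tpK : forall k, (K <= k)%N -> p <= tp P k <= q.
Hypothesis tqK : forall k, (K <= k)%N -> p <= tq P k <= q.

Lemma renorm_two_point : exists2 c : R, 0 < c & forall x y : X,
  lp2 q (renorm x) (c^-1 * renorm y) <= mean2 2 (renorm (x + y)) (renorm (x - y)) /\
  mean2 2 (renorm (x + y)) (renorm (x - y)) <= lp2 p (renorm x) (c * renorm y).
Proof.
have head_in a : (forall k, (K <= k)%N -> p <= a k <= q) -> forall k, p <= head2 a k <= q.
  by move=> aK k; rewrite /head2; case: ltnP => [_|/aK//]; rewrite p2 q2.
have [c c0 h] := @tnorm_two_point R F renormed p q p1 p2 q2 (head_in _ tpK) (head_in _ tqK).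
exists c => // x y; exact: (h _ _ (renorm_bounded x) (renorm_bounded y)).
Qed.

Lemma renorm_ge0 (x : X) : 0 <= renorm x.
Proof. by apply: tnorm_ge0; exact: renorm_bounded. Qed.

Lemma tree_space_convexity : convexity_power_type X q.
Proof.
have q0 : 0 < q by exact: lt_le_trans q2.
have [c c0 h] := renorm_two_point.
exists renorm; split; first exact: equivalent_renorm.
have d0 : 0 < c^-1 / 2 by rewrite divr_gt0// invr_gt0.
exists (q^-1 * (c^-1 / 2) `^ q); first by rewrite mulr_gt0 ?invr_gt0// powR_gt0.
move=> e e0 e2; apply/ereal_infP => _ [x [y [x1 y1 xy ->]]].
rewrite lee_fin.
pose f : X := 2^-1 *: (x + y); pose g : X := 2^-1 *: (x - y).
have fx : f + g = x.
  rewrite /f /g -scalerDr addrACA subrr addr0 -mulr2n -[x *+ 2](scaler_nat 2) scalerA.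
  by rewrite mulVf ?scale1r// pnatr_eq0.
have fy : f - g = y.
  rewrite /f /g -scalerBr opprB [y - x]addrC addrACA subrr add0r -mulr2n -[y *+ 2](scaler_nat 2) scalerA.
  by rewrite mulVf ?scale1r// pnatr_eq0.
have := (h f g).1; rewrite fx fy x1 y1.
have -> : mean2 2 1 1 = 1 :> R by rewrite mean2.unlock powR1 divff ?powR1// pnatr_eq0.
move=> /(ler_powR2r (ltW q0) (lp2_ge0 _ _ _)); rewrite powR1 lp2_powR// => le1.
have gE : renorm g = renorm (x - y) / 2.
  have [_ NZ _] := equivalent_renorm.
  by rewrite NZ (abs_scalar_natV 2) mulrC.
have ce : (c^-1 / 2) `^ q * e `^ q <= (c^-1 * renorm g) `^ q.
  rewrite -powRM ?(ltW d0) ?(ltW e0)//; apply: ler_powR2r; rewrite ?(ltW q0)//.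
    by rewrite mulr_ge0 ?(ltW d0) ?(ltW e0).
  by rewrite gE mulrCA mulrC ler_pM2r.
rewrite -mulrA mulrC ler_pdivrMr//.
have := bernoulli_powR_ge (le_trans (ler1n _ 2) q2) (renorm_ge0 f).
by move: (renorm f) (renorm f `^ q) (_ `^ q) (_ `^ q * _) le1 ce => A B C D; lra.
Qed.

Lemma tree_space_smoothness : smoothness_power_type X p.
Proof.
have p0 : 0 < p by exact: lt_trans p1.
have [c c0 h] := renorm_two_point.
exists renorm; split; first exact: equivalent_renorm.
exists (c `^ p); first exact: powR_gt0.
move=> tau tau0; apply/ereal_supP => _ [x [y [x1 y1 ->]]].
rewrite lee_fin lerBlDr.
have := (h x y).2; rewrite x1 y1 => le1.
have cp0 : 0 <= c `^ p * tau `^ p by rewrite mulr_ge0 ?powR_ge0.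
apply: (@le_trans _ _ (mean2 1 (renorm (x + y)) (renorm (x - y)))).
  rewrite mean2.unlock invr1 !powRr1 ?renorm_ge0//.
  by rewrite divr_ge0// addr_ge0// renorm_ge0.
apply: (@le_trans _ _ (mean2 2 (renorm (x + y)) (renorm (x - y)))).
  by apply: ler_mean2_exponent; rewrite ?renorm_ge0 ?ler1n.
apply: le_trans le1 _; rewrite lp2_def powR1 powRM ?(ltW c0) ?(ltW tau0)// addrC.
apply: ler1_powR; first by rewrite lerDr.
by rewrite invf_le1// ltW.
Qed.

End Renorming.
End PowerTypes.

(** * Walsh-Paley martingales *)

Section CoordinateSigmaAlgebra.
Context {n : nat}.
Implicit Types (w : cube n) (k : nat).

Definition agree k w w' := [forall i : 'I_n, (i < k)%N ==> (w i == w' i)].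

Lemma agreeP k w w' : reflect (forall i : 'I_n, (i < k)%N -> w i = w' i) (agree k w w').
Proof.
apply: (iffP forallP) => h i; first by move=> ik; have := h i; rewrite ik => /eqP.
by apply/implyP => ik; rewrite h.
Qed.

Lemma agree_sym k w w' : agree k w w' = agree k w' w.
Proof. by apply/agreeP/agreeP => h i ik; rewrite h. Qed.

Lemma agree_refl k w : agree k w w.
Proof. by apply/agreeP. Qed.

Lemma agree_trans k w1 w2 w3 : agree k w1 w2 -> agree k w2 w3 -> agree k w1 w3.
Proof. by move=> /agreeP h /agreeP h' ; apply/agreeP => i ik; rewrite h// h'. Qed.

Lemma agree_le k l w w' : (k <= l)%N -> agree l w w' -> agree k w w'.
Proof. by move=> kl /agreeP h; apply/agreeP => i ik; apply: h; exact: leq_trans kl. Qed.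

Lemma coord_sigmaC k (A : set (cube n)) : coord_sigma n k A -> coord_sigma n k (~` A).
Proof. by rewrite -setTD; exact: sigma_algebraCD. Qed.

Lemma coord_sigmaI k (A B : set (cube n)) :
  coord_sigma n k A -> coord_sigma n k B -> coord_sigma n k (A `&` B).
Proof.
move=> sA sB; rewrite -(setCK (A `&` B)) setCI; apply: coord_sigmaC.
rewrite -bigcup2E; apply: sigma_algebra_bigcup; case=> [|[|i]] /=.
- exact: coord_sigmaC.
- exact: coord_sigmaC.
- exact: sigma_algebra0.
Qed.

Lemma coord_sigma_cylinder k w : coord_sigma n k [set w' | agree k w w'].
Proof.
have H (s : seq 'I_n) : coord_sigma n k
    [set w' | forall i, i \in s -> (i < k)%N -> w i = w' i].
  elim: s => [|i s IH].
    rewrite (_ : [set w' | _] = ~` set0); last first.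
      by rewrite setC0; apply/seteqP; split => w' //= _ i.
    by apply: coord_sigmaC; exact: sigma_algebra0.
  rewrite (_ : [set w' | _] = [set w' | (i < k)%N -> w i = w' i] `&`
      [set w' | forall i, i \in s -> (i < k)%N -> w i = w' i]).
    apply: coord_sigmaI => //; have [ik|ki] := ltnP i k.
      apply: sub_sigma_algebra; exists i, (w i); split => //.
      by apply/seteqP; split => w' /= h; rewrite h.
    rewrite (_ : [set w' | _] = ~` set0); last first.
      by rewrite setC0; apply/seteqP; split => w' //= _ /(leq_ltn_trans ki); rewrite ltnn.
    by apply: coord_sigmaC; exact: sigma_algebra0.
  apply/seteqP; split => w' /=.
    move=> h; split; first by apply: h; rewrite mem_head.
    by move=> j js; apply: h; rewrite inE js orbT.
  by move=> [h1 h2] j; rewrite inE => /predU1P[->|]; [exact: h1|exact: h2].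
suff -> : [set w' | agree k w w'] = [set w' | forall i, i \in enum 'I_n -> (i < k)%N -> w i = w' i].
  exact: H.
apply/seteqP; split => w' /=; first by move=> /agreeP h i _; exact: h.
by move=> h; apply/agreeP => i; apply: h; rewrite mem_enum.
Qed.

Lemma coord_sigmaP k (A : set (cube n)) :
  coord_sigma n k A <-> (forall w w', agree k w w' -> A w -> A w').
Proof.
split.
  have : [set A : set (cube n) | forall w w', agree k w w' -> A w -> A w'] A ->
     (forall w w', agree k w w' -> A w -> A w') by [].
  move=> imp sA; apply: imp; apply: sA; split.
    split => //=.
    - move=> B hB w w' ww' [_ nB]; split => // Bw'; apply: nB.
      by apply: hB Bw'; rewrite agree_sym.
    - by move=> B hB w w' ww' [i _ Bi]; exists i => //; exact: hB Bi.
  by move=> B [i [b [ik ->]]] w w' /agreeP/(_ i ik) /= ->.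
move=> inv.
pose B j := if unpickle j is Some w then
  (if `[< A w >] then [set w' | agree k w w'] else set0) else set0.
rewrite (_ : A = \bigcup_j B j).
  apply: sigma_algebra_bigcup => j; rewrite /B.
  case: unpickle => [w|]; last exact: sigma_algebra0.
  by case: ifP => _; [exact: coord_sigma_cylinder|exact: sigma_algebra0].
apply/seteqP; split => w.
  move=> Aw; exists (pickle w) => //; rewrite /B pickleK.
  by case: asboolP => // _ /=; exact: agree_refl.
move=> [j _]; rewrite /B; case: unpickle => [w'|//].
by case: asboolP => // Aw' /= ww'; exact: inv Aw'.
Qed.

Definition flip (k : 'I_n) w : cube n := [ffun i => if i == k then ~~ w i else w i].

Lemma flipK (k : 'I_n) : involutive (flip k).
Proof. by move=> w; apply/ffunP => i; rewrite !ffunE; case: eqP => //; rewrite negbK. Qed.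

Lemma agree_flip (k : 'I_n) w : agree k w (flip k w).
Proof.
by apply/agreeP => i ik; rewrite ffunE; case: eqP ik => // ->; rewrite ltnn.
Qed.

Lemma agree_succ (k : 'I_n) w w' : agree k w w' ->
  agree k.+1 w w' \/ agree k.+1 (flip k w) w'.
Proof.
move=> /agreeP h; have [e|e] := eqVneq (w k) (w' k).
  left; apply/agreeP => i; rewrite ltnS leq_eqVlt => /predU1P[|]; last exact: h.
  by move=> /val_inj ->.
right; apply/agreeP => i; rewrite ltnS leq_eqVlt ffunE => /predU1P[|ik].
  by move=> /val_inj ->; rewrite eqxx; move: e; case: (w k); case: (w' k).
by rewrite -h//; case: eqP ik => // ->; rewrite ltnn.
Qed.

Lemma agree_flip_flip j (k : 'I_n) w w' : agree j w w' -> agree j (flip k w) (flip k w').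
Proof. by move=> /agreeP h; apply/agreeP => i ij; rewrite !ffunE h. Qed.

End CoordinateSigmaAlgebra.

Section Martingales.
Context {R : realType} {F : scalar_kind} (X : completeNormedModType (scalars R F)).
Context {n : nat}.
Implicit Types (M : nat -> cube n -> X) (f g : cube n -> X).
Local Notation K := (scalars R F).

Lemma coord_measurableP k f : coord_measurable k f <->
  (forall w w', agree k w w' -> f w = f w').
Proof.
split.
  move=> mf w w' ww'.
  have : <<s @open X >> [set f w].
    have oC : open (~` [set f w]).
      apply: closed_openC; apply: accessible_closed_set1.
      exact: hausdorff_accessible (@norm_hausdorff _ _).
    rewrite -(setCK [set f w]) -setTD; apply: sigma_algebraCD.
    exact: sub_sigma_algebra.
  by move=> /mf /coord_sigmaP /(_ w w' ww' erefl).
by move=> inv B sB; apply/coord_sigmaP => w w' /inv; rewrite /preimage/= => ->.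
Qed.

End Martingales.

Section WalshPaley.
Context {R : realType} {F : scalar_kind} (X : completeNormedModType (scalars R F)).
Context {n : nat}.
Local Notation K := (scalars R F).

Lemma martingale_agree (M : nat -> cube n -> X) k w w' :
  walsh_paley_martingale M -> (k <= n)%N -> agree k w w' -> M k w = M k w'.
Proof. by move=> [mM _] kn; apply: (coord_measurableP _ _).1; exact: mM. Qed.

Lemma card_cube_gt0 : (0 < #|{: cube n}|)%N.
Proof. by apply/card_gt0P; exists [ffun=> false]. Qed.

Lemma mean_inj (V : lmodType K) (f g : cube n -> V) :
  mean f = mean g -> \sum_w f w = \sum_w g w.
Proof.
move=> h; have n0 : (#|{: cube n}|%:R : K)^-1 != 0.
  by rewrite invr_eq0 pnatr_eq0 -lt0n card_cube_gt0.
exact: (scalerI n0).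
Qed.

Lemma martingale_flip (M : nat -> cube n -> X) (k : 'I_n) w :
  walsh_paley_martingale M ->
  M k.+1 (flip k w) - M k (flip k w) = - (M k.+1 w - M k w).
Proof.
move=> wM; have [_ eM] := wM; have kn := ltn_ord k.
pose A := [set w' | agree k w w'].
have sA : coord_sigma n k A by exact: coord_sigma_cylinder.
pose D w' := M k.+1 w' - M k w'.
have D0 : \sum_w' (\1_A w' : K) *: D w' = 0.
  under eq_bigr do rewrite scalerBr.
  by rewrite sumrB (mean_inj (eM k k.+1 (leqnSn k) kn A sA)) subrr.
have AE w' : \1_A w' = (agree k w w')%:R :> K.
  rewrite indicE; congr (nat_of_bool _)%:R.
  by apply/idP/idP => [/set_mem//|h]; apply/mem_set.
have A_flip w' : agree k w (flip k w') = agree k w w'.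
  apply/idP/idP => h; apply: agree_trans h _; last exact: agree_flip.
  by rewrite agree_sym agree_flip.
have DD w' : agree k w w' -> D w' + D (flip k w') = D w + D (flip k w).
  have Dag w1 w2 : agree k.+1 w1 w2 -> D w1 = D w2.
    move=> h; rewrite /D (martingale_agree wM kn h); congr (_ - _).
    by apply: (martingale_agree wM (ltnW kn)); exact: agree_le h.
  move=> /agree_succ[h|h].
    by rewrite (Dag _ _ h) (Dag (flip k w) (flip k w'))//; exact: agree_flip_flip.
  rewrite (Dag _ _ h) addrC (Dag w (flip k w'))//.
  by rewrite -[X in agree _ X _](flipK k) agree_flip_flip.
have D1 : \sum_w' ((agree k w w')%:R : K) *: D w' = 0.
  by rewrite -[RHS]D0; apply: eq_bigr => w' _; rewrite AE.
have D2 : \sum_w' ((agree k w w')%:R : K) *: D (flip k w') = 0.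
  rewrite -[RHS]D1 [RHS](reindex_inj (inv_inj (flipK k)))/=.
  by apply: eq_bigr => w' _; rewrite A_flip.
have : (\sum_w' (agree k w w')%:R : K) *: (D w + D (flip k w)) = 0.
  have <- : \sum_w' ((agree k w w')%:R : K) *: (D w' + D (flip k w')) = 0.
    by under eq_bigr do rewrite scalerDr; rewrite big_split/= D1 D2 addr0.
  rewrite scaler_suml; apply: eq_bigr => w' _.
  by have [h|_] := boolP (agree k w w'); rewrite ?scale0r// DD.
rewrite -natr_sum => /eqP; rewrite scaler_eq0 => /orP[|/eqP h]; last first.
  by apply/eqP; rewrite eq_sym eqr_oppLR addrC -addr_eq0 addrC; apply/eqP.
by rewrite pnatr_eq0 (bigD1 w)//= agree_refl.
Qed.

End WalshPaley.

Section L2Norm.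
Context {R : realType} {F : scalar_kind} (X : completeNormedModType (scalars R F)).
Local Notation K := (scalars R F).

Lemma real_scalar_rnorm (x : X) : real_scalar (rnorm x) = `|x|.
Proof.
have := normr_ge0 x; rewrite /rnorm /re_scalar /real_scalar; move: (`|x|).
by case: F => // -[u v]; rewrite lecE/= => /andP[/eqP -> _].
Qed.

Lemma rnorm_ge0 (x : X) : 0 <= rnorm x.
Proof.
by rewrite -(@ler_real_scalar R F) real_scalar_rnorm real_scalar0 normr_ge0.
Qed.

Lemma rnormZ (a : K) (x : X) : rnorm (a *: x) = abs_scalar a * rnorm x.
Proof.
apply: (@real_scalar_inj R F); rewrite real_scalarM -norm_real_scalar.
by rewrite !real_scalar_rnorm normrZ.
Qed.

Lemma rnormN (x : X) : rnorm (- x) = rnorm x.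
Proof. by rewrite -scaleN1r rnormZ abs_scalarN (abs_scalar_nat 1) mul1r. Qed.

Lemma L2norm_ge0 (T : finType) (f : T -> X) : 0 <= L2norm f.
Proof. exact: sqrtr_ge0. Qed.

Lemma L2norm_sqr (T : finType) (f : T -> X) :
  L2norm f ^+ 2 = #|T|%:R^-1 * \sum_w rnorm (f w) ^+ 2.
Proof.
rewrite /L2norm sqr_sqrtr// /mean; apply: mulr_ge0; first by rewrite invr_ge0.
by apply: sumr_ge0 => w _; rewrite sqr_ge0.
Qed.

Lemma eq_L2norm (T : finType) (f g : T -> X) :
  (forall w, rnorm (f w) = rnorm (g w)) -> L2norm f = L2norm g.
Proof.
move=> fg; apply/eqP; rewrite -(eqrXn2 (n := 2)) ?L2norm_ge0// !L2norm_sqr.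
by under eq_bigr do rewrite fg.
Qed.

Lemma L2norm_reindex (T : finType) (h : T -> T) (f : T -> X) : involutive h ->
  L2norm (f \o h) = L2norm f.
Proof.
move=> hK; apply/eqP; rewrite -(eqrXn2 (n := 2)) ?L2norm_ge0// !L2norm_sqr.
by rewrite [in eqbRHS](reindex_inj (inv_inj hK)).
Qed.

Lemma lp2_sqr r (a b : R) : 0 < r -> 0 <= a -> 0 <= b ->
  lp2 r a b ^+ 2 = lp2 (r / 2) (a ^+ 2) (b ^+ 2).
Proof.
move=> r0 a0 b0; have E x : 0 <= x -> (x ^+ 2) `^ (r / 2) = x `^ r :> R.
  by move=> x0; rewrite -(powR_mulrn 2 x0) -powRrM mulrCA mulfV ?mulr1 ?pnatr_eq0.
by rewrite !lp2_def !E// invf_div mulrC powRrM powR_mulrn ?powR_ge0.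
Qed.

Definition two_point (p q c : R) := forall x y : X,
  lp2 q (rnorm x) (c^-1 * rnorm y) <= mean2 2 (rnorm (x + y)) (rnorm (x - y)) /\
  mean2 2 (rnorm (x + y)) (rnorm (x - y)) <= lp2 p (rnorm x) (c * rnorm y).

Lemma L2norm_lower (T : finType) p q c (f g : T -> X) : two_point p q c ->
  2 <= q -> 0 < c ->
  lp2 q (L2norm f) (c^-1 * L2norm g) <=
  mean2 2 (L2norm (fun w => f w + g w)) (L2norm (fun w => f w - g w)).
Proof.
move=> tp q2 c0; have q0 : 0 < q by exact: lt_le_trans q2.
have cv : 0 <= c^-1 by rewrite invr_ge0 ltW.
have T0 : 0 <= #|T|%:R^-1 :> R by rewrite invr_ge0.
have rq : 1 <= q / 2 by rewrite ler_pdivlMr// mul1r.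
rewrite -ler_sqr ?nnegrE ?lp2_ge0 ?mean2_ge0//.
rewrite mean2_2 ?L2norm_ge0// lp2_sqr ?mulr_ge0 ?L2norm_ge0//.
rewrite exprMn !L2norm_sqr mulrCA -mulrDr -mulrA.
have S0 (h : T -> X) : 0 <= \sum_w rnorm (h w) ^+ 2.
  by apply: sumr_ge0 => w _; exact: sqr_ge0.
rewrite lp2Z ?mulr_ge0 ?sqr_ge0 ?divr_gt0//.
rewrite ler_wpM2l// mulr_sumr -big_split/= mulr_suml.
apply: le_trans (lp2_sum rq _ _) _; first by move=> w; exact: sqr_ge0.
  by move=> w; rewrite mulr_ge0 ?sqr_ge0.
apply: ler_sum => w _; rewrite -exprMn -lp2_sqr ?mulr_ge0 ?rnorm_ge0//.
rewrite -mean2_2 ?rnorm_ge0// ler_sqr ?nnegrE ?lp2_ge0 ?mean2_ge0//.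
exact: (tp _ _).1.
Qed.

Lemma L2norm_upper (T : finType) p q c (f g : T -> X) : two_point p q c ->
  0 < p -> p <= 2 -> 0 < c ->
  mean2 2 (L2norm (fun w => f w + g w)) (L2norm (fun w => f w - g w)) <=
  lp2 p (L2norm f) (c * L2norm g).
Proof.
move=> tp p0 p2 c0; have cv := ltW c0.
have T0 : 0 <= #|T|%:R^-1 :> R by rewrite invr_ge0.
have s0 : 0 < 2 / p by rewrite divr_gt0.
have s1 : 1 <= 2 / p by rewrite ler_pdivlMr// mul1r.
have E (x : R) : 0 <= x -> (x `^ p) `^ (2 / p) = x ^+ 2.
  by move=> x0; rewrite -powRrM mulrCA mulfV ?gt_eqF// mulr1 powR_mulrn.
have E' (x : R) : 0 <= x -> (x `^ (2 / p)^-1) = x `^ (p / 2) by rewrite invf_div.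
rewrite -ler_sqr ?nnegrE ?lp2_ge0 ?mean2_ge0// mean2_2 ?L2norm_ge0//.
rewrite -(E (lp2 p _ _)) ?lp2_ge0// lp2_powR//.
rewrite !L2norm_sqr -mulrDr -mulrA -big_split/= mulr_suml.
apply: (@le_trans _ _ (#|T|%:R^-1 *
   \sum_w (rnorm (f w) `^ p + (c * rnorm (g w)) `^ p) `^ (2 / p))).
  rewrite ler_wpM2l//; apply: ler_sum => w _.
  rewrite -mean2_2 ?rnorm_ge0// -lp2_powR// E ?lp2_ge0//.
  by rewrite ler_sqr ?nnegrE ?lp2_ge0 ?mean2_ge0//; exact: (tp _ _).2.
rewrite -lpnorm_powR// -[X in X * _](powRVK s0 T0) -powRM ?powR_ge0 ?lpnorm_ge0//.
apply: ler_powR2r; rewrite ?(ltW s0) ?mulr_ge0 ?powR_ge0 ?lpnorm_ge0//.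
apply: le_trans (ler_wpM2l (powR_ge0 _ _) (minkowski_lpnorm s1 _ _)) _.
- by move=> w; exact: powR_ge0.
- by move=> w; exact: powR_ge0.
rewrite mulrDr; have H (a : T -> R) (N : R) : (forall w, 0 <= a w) -> 0 <= N ->
    N ^+ 2 = #|T|%:R^-1 * \sum_w a w ^+ 2 ->
    #|T|%:R^-1 `^ (2 / p)^-1 * lpnorm (2 / p) (fun w => a w `^ p) = N `^ p.
  move=> a0 N0 NE; rewrite lpnorm.unlock -powRM ?sum_powR_ge0//.
  under eq_bigr do rewrite E//.
  rewrite -NE invf_div -(powR_mulrn 2 N0) -powRrM mulrCA mulfV ?mulr1 ?pnatr_eq0//.
rewrite (H _ (L2norm f)) ?L2norm_ge0 ?L2norm_sqr//; last by move=> w; exact: rnorm_ge0.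
rewrite (H _ (c * L2norm g)) ?mulr_ge0 ?L2norm_ge0//.
  by move=> w; rewrite mulr_ge0 ?rnorm_ge0.
rewrite exprMn L2norm_sqr mulrCA mulr_sumr.
by under eq_bigr do rewrite -exprMn.
Qed.

End L2Norm.

(** * The upper bound *)

Section RUMDUpper.
Context {R : realType} {F : scalar_kind} (X : completeNormedModType (scalars R F)).
Context {n : nat}.
Context (p q c : R) (p0 : 0 < p) (p2 : p <= 2) (q2 : 2 <= q) (c0 : 0 < c).
Hypothesis tp : two_point X p q c.
Local Notation K := (scalars R F).

Let q0 : 0 < q. Proof. exact: lt_le_trans q2. Qed.

Lemma mean2_diag r (a : R) : 0 < r -> 0 <= a -> mean2 r a a = a.
Proof.
move=> r0 a0; rewrite mean2.unlock -mulr2n -[a `^ r *+ 2]mulr_natr mulfK ?pnatr_eq0//.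
by rewrite powRKV.
Qed.

Section Martingale.
Context (M : nat -> cube n -> X) (wM : walsh_paley_martingale M).

Local Notation D k := (fun w => M k.+1 w - M k w).

Lemma martingale_step_lower (k : 'I_n) :
  (L2norm (M k)) `^ q + (c^-1 * L2norm (D k)) `^ q <= (L2norm (M k.+1)) `^ q.
Proof.
have := L2norm_lower (M k) (D k) tp q2 c0.
have -> : L2norm (fun w => M k w + D k w) = L2norm (M k.+1).
  by apply: eq_L2norm => w; rewrite addrC subrK.
have -> : L2norm (fun w => M k w - D k w) = L2norm (M k.+1).
  rewrite -[RHS](L2norm_reindex _ (flipK k)); apply: eq_L2norm => w /=.
  rewrite -(martingale_flip _ _ wM) (martingale_agree (w' := w) wM (ltnW (ltn_ord k))).
    by rewrite addrC subrK.
  by rewrite agree_sym agree_flip.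
rewrite mean2_diag ?L2norm_ge0// => /(ler_powR2r (ltW q0) (lp2_ge0 _ _ _)).
by rewrite lp2_powR.
Qed.

Lemma martingale_cotype m : (m <= n)%N ->
  \sum_(k < m) (c^-1 * L2norm (D k)) `^ q <= (L2norm (M m)) `^ q.
Proof.
elim: m => [_|m IH mn]; first by rewrite big_ord0 powR_ge0.
rewrite big_ord_recr/=; apply: le_trans (martingale_step_lower (Ordinal mn)).
by rewrite lerD2r IH// ltnW.
Qed.

Definition signed_partial_sum m (ew : cube n * cube n) : X :=
  \sum_(k < n | (k < m)%N) ((-1) ^+ ew.1 k : K) *: (M k.+1 ew.2 - M k ew.2).

Local Notation S := signed_partial_sum.

Lemma signed_partial_sumS (m : 'I_n) ew :
  S m.+1 ew = S m ew + ((-1) ^+ ew.1 m : K) *: (M m.+1 ew.2 - M m ew.2).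
Proof.
rewrite /S (bigD1 m)/=; last by rewrite ltnS.
rewrite addrC; congr (_ + _); apply: eq_bigl => k.
by rewrite ltnS (leq_eqVlt k) -val_eqE/=; case: (ltngtP k m).
Qed.

Lemma signed_sum_step_upper (m : 'I_n) :
  (L2norm (S m.+1)) `^ p <= (L2norm (S m)) `^ p + (c * L2norm (D m)) `^ p.
Proof.
pose g (ew : cube n * cube n) := ((-1) ^+ ew.1 m : K) *: (M m.+1 ew.2 - M m ew.2).
have := L2norm_upper (S m) g tp p0 p2 c0.
have -> : L2norm (fun ew => S m ew + g ew) = L2norm (S m.+1).
  by apply: eq_L2norm => ew; rewrite signed_partial_sumS.
pose h (ew : cube n * cube n) := (flip m ew.1, ew.2).
have hK : involutive h by case=> e w; rewrite /h/= flipK.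
have -> : L2norm (fun ew => S m ew - g ew) = L2norm (S m.+1).
  rewrite -[RHS](L2norm_reindex _ hK); apply: eq_L2norm => -[e w] /=.
  rewrite signed_partial_sumS /g/=; congr (rnorm (_ + _)).
    apply: eq_bigr => k km /=; rewrite ffunE; case: eqP => // kE.
    by rewrite kE ltnn in km.
  by rewrite ffunE eqxx signrN scaleNr.
have -> : L2norm g = L2norm (D m).
  apply/eqP; rewrite -(eqrXn2 (n := 2)) ?L2norm_ge0// !L2norm_sqr.
  have -> : \sum_ew rnorm (g ew) ^+ 2 = \sum_(e : cube n) \sum_w rnorm (D m w) ^+ 2.
    rewrite pair_bigA; apply: eq_bigr => -[e w] _.
    by rewrite /g rnormZ abs_scalar_sign mul1r.
  apply/eqP; rewrite sumr_const card_prod natrM invfM -[X in _ * X = _]mulr_natl mulrACA.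
  by rewrite mulVf ?mul1r// pnatr_eq0 -lt0n card_cube_gt0.
rewrite mean2_diag ?L2norm_ge0// => /(ler_powR2r (ltW p0) (L2norm_ge0 _)).
by rewrite lp2_powR.
Qed.

Lemma signed_sum_type m : (m <= n)%N ->
  (L2norm (S m)) `^ p <= \sum_(k < m) (c * L2norm (D k)) `^ p.
Proof.
elim: m => [_|m IH mn].
  rewrite big_ord0 (_ : L2norm _ = 0) ?powR0 ?gt_eqF//.
  apply/eqP; rewrite -(eqrXn2 (n := 2)) ?L2norm_ge0// L2norm_sqr expr0n.
  rewrite big1 ?mulr0// => ew _; rewrite /S big_pred0//.
  by rewrite -(scale0r 0) rnormZ abs_scalar0 mul0r expr0n.
rewrite big_ord_recr/=; apply: le_trans (signed_sum_step_upper (Ordinal mn)) _.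
by rewrite lerD2r IH// ltnW.
Qed.

Lemma signed_sum_le :
  L2norm (S n) <= c ^+ 2 * n%:R `^ (p^-1 - q^-1) * L2norm (M n).
Proof.
set A := L2norm (M n).
have A0 : 0 <= A by exact: L2norm_ge0.
have pq0 : 0 < p / q by rewrite divr_gt0.
have pq1 : p / q <= 1 by rewrite ler_pdivrMr// mul1r (le_trans p2).
have cn : 0 <= c by exact: ltW.
pose y (k : 'I_n) := (c * L2norm (D k)) `^ q.
have yE (k : 'I_n) : (c * L2norm (D k)) `^ p = y k `^ (p / q).
  by rewrite /y -powRrM mulrCA mulfV ?mulr1// gt_eqF.
have y0 k : 0 <= y k by exact: powR_ge0.
have sy : \sum_k y k <= (c ^+ 2 * A) `^ q.
  rewrite powRM ?sqr_ge0//; apply: le_trans (ler_wpM2l (powR_ge0 _ _) (martingale_cotype (leqnn n))).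
  rewrite mulr_sumr; apply: ler_sum => k _.
  rewrite -powRM ?sqr_ge0 ?mulr_ge0 ?invr_ge0 ?L2norm_ge0//.
  by rewrite mulrA expr2 mulfK// gt_eqF.
have h := signed_sum_type (leqnn n).
have {}h : L2norm (S n) `^ p <= n%:R `^ (1 - p / q) * (c ^+ 2 * A) `^ p.
  apply: le_trans h _; under eq_bigr do rewrite yE.
  apply: le_trans (sum_powR_le pq0 pq1 y0) _; rewrite card_ord ler_wpM2l ?powR_ge0//.
  have -> : (c ^+ 2 * A) `^ p = ((c ^+ 2 * A) `^ q) `^ (p / q).
    by rewrite -powRrM mulrCA mulfV ?mulr1// gt_eqF.
  by apply: ler_powR2r => //; [exact: ltW|exact: sumr_ge0].
rewrite ler_powRV ?L2norm_ge0 ?mulr_ge0 ?powR_ge0// in h; apply: le_trans h _.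
rewrite powRM ?powR_ge0// powRKV ?mulr_ge0 ?sqr_ge0// -powRrM mulrBl mul1r.
rewrite [p / q]mulrC mulfK ?gt_eqF//.
by rewrite mulrA [c ^+ 2 * _]mulrC.
Qed.

End Martingale.

Lemma RUMD_le : (0 < n)%N ->
  (RUMD X n <= (c ^+ 2 * n%:R `^ (p^-1 - q^-1))%:E)%E.
Proof.
move=> n0; apply: ereal_inf_lbound; exists (c ^+ 2 * n%:R `^ (p^-1 - q^-1)) => //.
split; first by rewrite mulr_gt0 ?exprn_gt0// powR_gt0// ltr0n.
move=> M wM M0; apply: le_trans (signed_sum_le wM).
rewrite le_eqVlt; apply/orP; left; apply/eqP; apply: eq_L2norm => ew.
by congr rnorm; apply: eq_bigl => k; rewrite ltn_ord.
Qed.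

End RUMDUpper.

(** * The lower bound *)

Section ConditionalMeans.
Context {R : realType} {F : scalar_kind} (X : completeNormedModType (scalars R F)).
Context {n : nat}.
Local Notation K := (scalars R F).

Definition glue k (w w' : cube n) : cube n := [ffun i : 'I_n => if (i < k)%N then w i else w' i].

Lemma agree_glue k w w' : agree k w (glue k w w').
Proof. by apply/agreeP => i ik; rewrite ffunE ik. Qed.

Lemma glueK k w w' : glue k (glue k w w') (glue k w' w) = w.
Proof. by apply/ffunP => i; rewrite !ffunE; case: ltnP. Qed.

Lemma eq_glue k w1 w2 w' : agree k w1 w2 -> glue k w1 w' = glue k w2 w'.
Proof. by move=> /agreeP h; apply/ffunP => i; rewrite !ffunE; case: ltnP => // /h. Qed.

Lemma glue0 w w' : glue 0 w w' = w'.
Proof. by apply/ffunP => i; rewrite !ffunE ltn0. Qed.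

Lemma gluen w w' : glue n w w' = w.
Proof. by apply/ffunP => i; rewrite !ffunE ltn_ord. Qed.

Definition cond_mean (f : cube n -> X) k w : X := mean (fun w' => f (glue k w w')).

Lemma card_cube_neq0 : (#|{: cube n}|%:R : K) != 0.
Proof. by rewrite pnatr_eq0 -lt0n card_cube_gt0. Qed.

Lemma mean_cst (x : X) : mean (fun _ : cube n => x) = x.
Proof.
by rewrite /mean sumr_const -[x *+ _](scaler_nat #|{: cube n}|) scalerA mulVf ?scale1r ?card_cube_neq0.
Qed.

Lemma cond_mean_sum (f : cube n -> X) k l (A : set (cube n)) : coord_sigma n k A -> (k <= l)%N ->
  \sum_w (\1_A w : K) *: cond_mean f l w = \sum_w (\1_A w : K) *: f w.
Proof.
move=> /coord_sigmaP sA kl.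
pose h (ww : cube n * cube n) := (glue l ww.1 ww.2, glue l ww.2 ww.1).
have hK : involutive h by case=> w w'; rewrite /h/= !glueK.
under eq_bigr do rewrite /cond_mean /mean scalerA mulrC -scalerA scaler_sumr.
rewrite -scaler_sumr pair_bigA/= (reindex_inj (inv_inj hK))/=.
have -> : \sum_(ww : cube n * cube n) (\1_A (glue l ww.1 ww.2) : K) *:
    f (glue l (glue l ww.1 ww.2) (glue l ww.2 ww.1)) =
    \sum_(w : cube n) \sum_(w' : cube n) (\1_A w : K) *: f w.
  rewrite pair_bigA; apply: eq_bigr => -[w w'] _ /=; rewrite glueK; congr (_ *: _).
  rewrite !indicE; congr (nat_of_bool _)%:R.
  have ag : agree k w (glue l w w') by exact: agree_le kl (agree_glue _ _ _).
  apply/idP/idP => /set_mem h1; apply/mem_set; apply: sA h1 => //.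
  by rewrite agree_sym.
rewrite scaler_sumr; apply: eq_bigr => w _.
exact: (mean_cst (\1_A w *: f w)).
Qed.

Lemma cond_mean_martingale (f : cube n -> X) : walsh_paley_martingale (cond_mean f).
Proof.
split.
  move=> k kn; apply/coord_measurableP => w w' ww'.
  by rewrite /cond_mean; congr mean; apply/funext => v; rewrite (eq_glue _ ww').
by move=> k l kl ln A sA; rewrite /mean !(cond_mean_sum _ sA).
Qed.

Lemma rnormD (x y : X) : rnorm (x + y) <= rnorm x + rnorm y.
Proof.
by rewrite -(@ler_real_scalar R F) real_scalarD !real_scalar_rnorm ler_normD.
Qed.

Lemma rnorm_mean_le (f : cube n -> X) (B : R) : (forall w, rnorm (f w) <= B) ->
  rnorm (mean f) <= B.
Proof.
move=> fB; rewrite /mean rnormZ abs_scalar_natV mulrC ler_pdivrMr ?ltr0n ?card_cube_gt0//.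
apply: (@le_trans _ _ (\sum_(w : cube n) B)); last by rewrite sumr_const mulr_natr.
elim/big_ind2 : _ => // [|x a y b xa yb].
  by rewrite -(scale0r 0) rnormZ abs_scalar0 mul0r.
by apply: le_trans (rnormD _ _) _; exact: lerD.
Qed.

End ConditionalMeans.

Section L2Bounds.
Context {R : realType} {F : scalar_kind} (X : completeNormedModType (scalars R F)).

Lemma L2norm_le (T : finType) (f : T -> X) (B : R) : (0 < #|T|)%N -> 0 <= B ->
  (forall w, rnorm (f w) <= B) -> L2norm f <= B.
Proof.
move=> T0 B0 fB; rewrite -ler_sqr ?nnegrE ?L2norm_ge0// L2norm_sqr mulrC.
rewrite ler_pdivrMr ?ltr0n//.
apply: (@le_trans _ _ (\sum_(w : T) B ^+ 2)); last by rewrite sumr_const mulr_natr.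
by apply: ler_sum => w _; rewrite ler_sqr ?nnegrE ?rnorm_ge0.
Qed.

Lemma mean_rnorm_le (T : finType) (f : T -> X) : (0 < #|T|)%N ->
  \sum_w rnorm (f w) <= #|T|%:R * L2norm f.
Proof.
move=> T0; have h0 : 0 < 2^-1 :> R by rewrite invr_gt0.
have h1 : 2^-1 <= 1 :> R by rewrite invf_le1// ler1n.
have := @sum_powR_le R T 2^-1 (fun w => rnorm (f w) ^+ 2) h0 h1 (fun w => sqr_ge0 _).
have E (x : R) : 0 <= x -> (x ^+ 2) `^ 2^-1 = x.
  by move=> x0; rewrite powR12_sqrt ?sqr_ge0// sqrtr_sqr ger0_norm.
under eq_bigr do rewrite E ?rnorm_ge0//.
move=> /le_trans; apply.
have -> : \sum_w rnorm (f w) ^+ 2 = #|T|%:R * L2norm f ^+ 2.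
  by rewrite L2norm_sqr mulrA mulfV ?mul1r// pnatr_eq0 -lt0n.
rewrite powRM ?sqr_ge0// E ?L2norm_ge0// mulrA -powRD ?subrK ?powRr1//.
by rewrite oner_eq0.
Qed.

End L2Bounds.

Section TreeMartingale.
Context {R : realType} {F : scalar_kind} (P : tree_params R).
Context {n : nat}.
Local Notation K := (scalars R F).
Local Notation X := (banach_tree_space F P).

Definition word (w : cube n) : seq bool := [seq w i | i <- enum 'I_n].

Lemma size_word w : size (word w) = n.
Proof. by rewrite size_map size_enum_ord. Qed.

Lemma nth_word w (i : 'I_n) : nth false (word w) i = w i.
Proof.
by rewrite (nth_map i) ?size_enum_ord// nth_ord_enum.
Qed.

Lemma take_word (j : 'I_n) w w' : agree j w w' -> take j (word w) = take j (word w').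
Proof.
have jn : (j <= n)%N by exact: ltnW.
move=> /agreeP h; apply: (@eq_from_nth _ false) => [|i].
  by rewrite !size_take !size_word.
rewrite size_takel ?size_word// => ij; rewrite !nth_take//.
have ii : (i < n)%N by exact: leq_trans jn.
by rewrite (nth_word w (Ordinal ii)) (nth_word w' (Ordinal ii)) h.
Qed.

Lemma prefix_sibling (j : 'I_n) w w' : agree j w w' ->
  prefix (sibling (word w) j) (word w') = (w' j != w j).
Proof.
move=> ag; rewrite prefixE /sibling size_rcons size_takel ?size_word 1?ltnW//.
rewrite (take_nth false) ?size_word// (take_word ag) eqseq_rcons eqxx/= !nth_word.
by case: (w j); case: (w' j).
Qed.

Definition branch_fun (w : cube n) : seq bool -> K := fun t => (prefix t (word w))%:R.

Lemma branch_fun_finite w t : (n.+1 <= size t)%N -> branch_fun w t = 0.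
Proof.
move=> nt; rewrite /branch_fun; case: prefixP => // -[s wE].
by have := size_word w; rewrite wE size_cat => e; rewrite -e ltnNge leq_addr in nt.
Qed.

Lemma branch_fun_bounded w : branch_fun w \in tree_bounded_pred F P.
Proof. by apply/asboolP; exact: tree_bounded_finite (@branch_fun_finite w). Qed.

Definition branch w : X := TreeSpace (branch_fun_bounded w).

Lemma rnorm_branch_le q w : 0 < q -> (forall j, (j < n)%N -> q <= tq P j) ->
  rnorm (branch w) <= n.+1%:R `^ q^-1.
Proof.
move=> q0 hq; rewrite rnorm_tree_space.
rewrite (tnorm_finite _ (@branch_fun_finite w)) /trunc_norm.
have := @tree_norm_branch_le _ _ _ (@tp_ge1 _ P) (@tq_ge1 _ P) q n.+1 0 (word w) q0.
rewrite add0n size_word => /(_ hq); apply: le_trans.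
rewrite le_eqVlt; apply/orP; left; apply/eqP; apply: eq_tree_norm => t.
exact: abs_scalar_nat.
Qed.

Definition branch_mean : X := mean branch.

Definition centered_branch (w : cube n) : X := branch w - branch_mean.

Definition branch_martingale : nat -> cube n -> X := cond_mean centered_branch.

Local Notation M := branch_martingale.

Lemma branch_martingale0 w : M 0 w = 0.
Proof.
rewrite /branch_martingale /cond_mean.
rewrite (_ : (fun w' => _) = centered_branch); last first.
  by apply/funext => w'; rewrite glue0.
rewrite /mean sumrB scalerBr; apply/eqP; rewrite subr_eq0; apply/eqP.
by rewrite -[LHS]/branch_mean -[RHS]/(mean (fun=> branch_mean)) mean_cst.
Qed.

Lemma branch_martingalen w : M n w = centered_branch w.
Proof.
rewrite /branch_martingale /cond_mean (_ : (fun w' => _) = fun=> centered_branch w).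
  exact: mean_cst.
by apply/funext => w'; rewrite gluen.
Qed.

Lemma L2norm_branch_martingale_le q : 0 < q -> (forall j, (j < n)%N -> q <= tq P j) ->
  L2norm (M n) <= 2 * n.+1%:R `^ q^-1.
Proof.
move=> q0 hq; apply: L2norm_le; first exact: card_cube_gt0.
  by rewrite mulr_ge0 ?powR_ge0.
move=> w; rewrite branch_martingalen mulr_natl mulr2n.
apply: le_trans (rnormD _ _) _; rewrite rnormN; apply: lerD.
  exact: rnorm_branch_le.
by apply: rnorm_mean_le => v; exact: rnorm_branch_le.
Qed.

Lemma tree_valB (x y : X) t : tree_val (x - y) t = tree_val x t - tree_val y t.
Proof. by []. Qed.

Lemma tree_valZ (a : K) (x : X) t : tree_val (a *: x) t = a * tree_val x t.
Proof. by []. Qed.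

Lemma tree_val_sum (I : finType) (f : I -> X) t :
  tree_val (\sum_i f i : X) t = \sum_i tree_val (f i) t.
Proof.
by rewrite (big_morph (fun x : X => tree_val x t) (id1 := 0) (op1 := +%R)).
Qed.

Lemma tree_val_mean (f : cube n -> X) t :
  tree_val (mean f : X) t = (#|{: cube n}|%:R : K)^-1 * \sum_w tree_val (f w) t.
Proof. by rewrite /mean tree_valZ tree_val_sum. Qed.

Lemma branch_martingale_val k w t :
  tree_val (M k w) t = (#|{: cube n}|%:R : K)^-1 *
    (\sum_w' ((prefix t (word (glue k w w')))%:R : K)) - tree_val branch_mean t.
Proof.
rewrite tree_val_mean.
under eq_bigr do rewrite tree_valB.
rewrite sumrB mulrBr; congr (_ - _).
by rewrite sumr_const -[X in _ * X = _]mulr_natl mulrA mulVf ?mul1r ?card_cube_neq0.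
Qed.

Lemma branch_martingale_diff (j : 'I_n) w :
  tree_val (M j.+1 w - M j w) (sibling (word w) j) = - 2^-1.
Proof.
rewrite tree_valB !branch_martingale_val.
rewrite opprB addrA subrK.
under eq_bigr => w' _.
  rewrite prefix_sibling; last by apply: agree_le (agree_glue _ _ _); exact: leqnSn.
  rewrite ffunE ltnSn eqxx; over.
rewrite big1// mulr0 sub0r; congr (- _).
under eq_bigr => w' _ do rewrite (prefix_sibling (agree_glue _ _ _)) ffunE ltnn.
set S := \sum_w' _.
have S2 : S + S = #|{: cube n}|%:R.
  rewrite {2}/S (reindex_inj (inv_inj (flipK j)))/= -big_split/=.
  rewrite -sum1_card natr_sum; apply: eq_bigr => w' _.
  by rewrite ffunE eqxx -natrD; case: (w j); case: (w' j).
have -> : S = #|{: cube n}|%:R / 2 by rewrite -S2 -mulr2n -[S *+ 2]mulr_natr mulfK// pnatr_eq0.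
by rewrite mulrA mulVf ?mul1r ?card_cube_neq0.
Qed.

Local Notation S := (fun ew : cube n * cube n =>
  \sum_(k < n) ((-1) ^+ ew.1 k : K) *: (M k.+1 ew.2 - M k ew.2)).

(* Flipping the sign [e j] changes the sum by twice the increment [j], whose value
   at the sibling node is [-1/2]. *)
Lemma signed_sum_sibling_ge (j : 'I_n) (e w : cube n) :
  1 <= abs_scalar (tree_val (S (e, w)) (sibling (word w) j)) +
       abs_scalar (tree_val (S (flip j e, w)) (sibling (word w) j)).
Proof.
set t := sibling _ _.
have E : S (e, w) - S (flip j e, w) = (2 * (-1) ^+ e j : K) *: (M j.+1 w - M j w).
  rewrite /= (bigD1 j)//= [in X in _ - X](bigD1 j)//= ffunE eqxx signrN scaleNr.
  rewrite opprD opprK addrACA -mulr2n -[_ *+ 2](scaler_nat 2) scalerA.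
  rewrite [X in _ + X](_ : _ = 0) ?addr0//; apply/eqP; rewrite subr_eq0; apply/eqP.
  by apply: eq_bigr => k kj; rewrite ffunE (negbTE kj).
rewrite -(abs_scalarN (tree_val (S (flip j e, w)) t)).
apply: le_trans (abs_scalarD _ _).
rewrite -tree_valB E tree_valZ branch_martingale_diff.
rewrite !abs_scalarM abs_scalar_sign abs_scalarN (abs_scalar_nat 2) (abs_scalar_natV 2).
by rewrite mulr1 mulfV// pnatr_eq0.
Qed.

Lemma sum_signed_sum_sibling_ge (j : 'I_n) :
  #|{: cube n * cube n}|%:R / 2 <=
  \sum_ew abs_scalar (tree_val (S ew) (sibling (word ew.2) j)).
Proof.
rewrite ler_pdivrMr// mulr_natr mulr2n.
pose h (ew : cube n * cube n) := (flip j ew.1, ew.2).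
have hK : involutive h by case=> e w; rewrite /h/= flipK.
rewrite [X in _ <= _ + X](reindex_inj (inv_inj hK))/= -big_split/=.
rewrite -sum1_card natr_sum; apply: ler_sum => -[e w] _.
exact: signed_sum_sibling_ge.
Qed.

Lemma rnorm_siblings_ge p (x : X) w : 1 <= p -> (forall j, (j < n)%N -> tp P j <= p) ->
  \sum_(j < n) abs_scalar (tree_val x (sibling (word w) j)) <=
  n%:R `^ (1 - p^-1) * rnorm x.
Proof.
move=> p1 hp; have p0 : 0 < p by exact: lt_le_trans p1.
pose g t := abs_scalar (tree_val x t).
have g0 t : 0 <= g t by exact: abs_scalar_ge0.
have pv0 : 0 < p^-1 by rewrite invr_gt0.
have pv1 : p^-1 <= 1 by rewrite invf_le1.
have := @sum_powR_le R 'I_n p^-1 (fun j => g (sibling (word w) j) `^ p) pv0 pv1 (fun j => powR_ge0 _ _).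
under eq_bigr do rewrite powRKV//.
move=> /le_trans; apply; rewrite card_ord ler_wpM2l ?powR_ge0// rnorm_tree_space.
apply: le_trans (trunc_norm_le n.+1 (tree_val_bounded x)).
have := @tree_norm_siblings_ge _ _ _ (@tp_ge1 _ P) (@tq_ge1 _ P) p n.+1 0 (word w) g p0 g0.
by rewrite add0n size_word; apply.
Qed.

Lemma L2norm_signed_sum_ge p : (0 < n)%N -> 1 <= p -> (forall j, (j < n)%N -> tp P j <= p) ->
  n%:R `^ p^-1 / 2 <= L2norm S.
Proof.
move=> n0 p1 hp.
have nn : 0 < n%:R :> R by rewrite ltr0n.
have N0 : (0 < #|{: cube n * cube n}|)%N by rewrite card_prod muln_gt0 card_cube_gt0.
have N0' : 0 < #|{: cube n * cube n}|%:R :> R by rewrite ltr0n.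
rewrite -(ler_pM2l N0'); apply: le_trans (mean_rnorm_le _ N0).
rewrite -(@ler_pM2l _ (n%:R `^ (1 - p^-1))) ?powR_gt0// mulr_sumr.
apply: (@le_trans _ _ (\sum_ew \sum_(j < n) abs_scalar (tree_val (S ew) (sibling (word ew.2) j)))); last first.
  by apply: ler_sum => ew _; exact: rnorm_siblings_ge.
rewrite exchange_big/=.
apply: (@le_trans _ _ (\sum_(j < n) #|{: cube n * cube n}|%:R / 2)); last first.
  by apply: ler_sum => j _; exact: sum_signed_sum_sibling_ge.
rewrite sumr_const card_ord -[leRHS]mulr_natl.
have nE : n%:R = n%:R `^ (1 - p^-1) * n%:R `^ p^-1 :> R.
  by rewrite -powRD ?subrK ?powRr1 ?(ltW nn)// (gt_eqF nn) implybT.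
rewrite [X in _ <= X * _]nE; move: (_ `^ _) (_ `^ _) => a b.
by rewrite le_eqVlt; apply/orP; left; apply/eqP; ring.
Qed.

Lemma RUMD_ge p q : (0 < n)%N -> 1 <= p -> 1 <= q ->
  (forall j, (j < n)%N -> tp P j <= p) -> (forall j, (j < n)%N -> q <= tq P j) ->
  ((8^-1 * n%:R `^ (p^-1 - q^-1))%:E <= RUMD X n)%E.
Proof.
move=> n0 p1 q1 hp hq; have q0 : 0 < q by exact: lt_le_trans q1.
have nn : 0 < n%:R :> R by rewrite ltr0n.
apply/ereal_infP => _ [c [c0 hc] <-]; rewrite lee_fin.
have h := hc M (cond_mean_martingale _) branch_martingale0.
have {}h := le_trans (L2norm_signed_sum_ge n0 p1 hp) h.
have {}h := le_trans h (ler_wpM2l (ltW c0) (L2norm_branch_martingale_le q0 hq)).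
have n1 : n.+1%:R `^ q^-1 <= 2 * n%:R `^ q^-1 :> R.
  apply: (@le_trans _ _ ((2 * n%:R) `^ q^-1)).
    apply: ler_powR2r; rewrite ?invr_ge0 ?(ltW q0)//.
    by rewrite -natrM ler_nat mul2n -addnn -addn1 leq_add2l.
  rewrite powRM// ler_wpM2r ?powR_ge0//; apply: ler1_powR; rewrite ?ler1n//.
  by rewrite invf_le1.
have nq : 0 < n%:R `^ q^-1 :> R by exact: powR_gt0.
rewrite powRB ?(gt_eqF nn) ?implybT// mulrA ler_pdivrMr//.
have := ler_wpM2l (ltW c0) n1; lra.
Qed.

End TreeMartingale.

(** * Exponents tending slowly to two *)

Lemma tree_space_two_point (R : realType) (F : scalar_kind) (P : tree_params R) (p q : R) :
  1 < p -> p <= 2 -> 2 <= q ->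
  (forall k, p <= tp P k <= q) -> (forall k, p <= tq P k <= q) ->
  exists2 c : R, 0 < c & two_point (banach_tree_space F P) p q c.
Proof.
move=> p1 p2 q2 hp hq; have [c c0 h] := @tnorm_two_point R F P p q p1 p2 q2 hp hq.
exists c => // x y; rewrite !rnorm_tree_space.
exact: (h _ _ (tree_val_bounded x) (tree_val_bounded y)).
Qed.

Section SlowlyVaryingExponents.
Context {R : realType}.

Lemma ln_nat_le m n : (m <= n)%N -> ln (m%:R : R) <= ln n%:R.
Proof.
case: m => [_|m mn].
  case: n => [//|n]; rewrite ln0//; apply: ln_ge0; by rewrite ler1n.
by rewrite ler_ln ?posrE ?ltr0n ?ler_nat// (leq_trans _ mn).
Qed.

Definition slow_sqrt (n : nat) : R := Num.sqrt (2 + ln n%:R).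

Lemma slow_arg_ge n : 2 <= 2 + ln n%:R :> R.
Proof. by rewrite lerDl -(ln0 (lexx 0)); exact: (@ln_nat_le 0 n). Qed.

Lemma slow_sqrt_sqr n : slow_sqrt n ^+ 2 = 2 + ln n%:R.
Proof. by rewrite sqr_sqrtr// (le_trans _ (slow_arg_ge n)). Qed.

Lemma slow_sqrt_gt1 n : 1 < slow_sqrt n.
Proof.
rewrite -[ltLHS]sqrtr1 ltr_sqrt; have := slow_arg_ge n; lra.
Qed.

Lemma slow_sqrt_le m n : (m <= n)%N -> slow_sqrt m <= slow_sqrt n.
Proof. by move=> mn; apply: ler_wsqrtr; rewrite lerD2l ln_nat_le. Qed.

Lemma slow_sqrt_infty (B : R) : \forall n \near \oo, B <= slow_sqrt n.
Proof.
near=> n; have [B0|B0] := leP B 0.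
  by rewrite (le_trans B0)// sqrtr_ge0.
rewrite -ler_sqr ?nnegrE ?(ltW B0) ?sqrtr_ge0// slow_sqrt_sqr.
rewrite -[leLHS]add0r lerD// -[leLHS]expRK ler_ln ?posrE ?expR_gt0//.
  by near: n; exact: nbhs_infty_ger.
by rewrite ltr0n; near: n; exact: nbhs_infty_gt.
Unshelve. all: by end_near. Qed.

Definition slow_p n : R := 2 / (1 + (slow_sqrt n)^-1).
Definition slow_q n : R := 2 / (1 - (slow_sqrt n)^-1).

Lemma slow_inv n : 0 < (slow_sqrt n)^-1 < 1.
Proof.
have s1 := slow_sqrt_gt1 n; have s0 : 0 < slow_sqrt n by lra.
by rewrite invr_gt0 s0 invf_lt1.
Qed.

Lemma slow_p_ge1 n : 1 <= slow_p n.
Proof.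
have /andP[d0 d1] := slow_inv n; rewrite /slow_p ler_pdivlMr; lra.
Qed.

Lemma slow_q_ge2 n : 2 <= slow_q n.
Proof.
have /andP[d0 d1] := slow_inv n; rewrite /slow_q ler_pdivlMr; lra.
Qed.

Lemma slow_p_le2 n : slow_p n <= 2.
Proof.
have /andP[d0 d1] := slow_inv n; rewrite /slow_p ler_pdivrMr; lra.
Qed.

Lemma slow_q_ge1 n : 1 <= slow_q n.
Proof. by have := slow_q_ge2 n; lra. Qed.

Lemma slow_inv_le m n : (m <= n)%N -> (slow_sqrt n)^-1 <= (slow_sqrt m)^-1.
Proof.
move=> /slow_sqrt_le mn; have := slow_sqrt_gt1 m; have := slow_sqrt_gt1 n => ? ?.
rewrite lef_pV2// posrE; lra.
Qed.

Lemma slow_p_le m n : (m <= n)%N -> slow_p m <= slow_p n.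
Proof.
move=> /slow_inv_le h; have /andP[a b] := slow_inv m; have /andP[c d] := slow_inv n.
rewrite /slow_p ler_pM2l//; rewrite lef_pV2 ?posrE; lra.
Qed.

Lemma slow_q_le m n : (m <= n)%N -> slow_q n <= slow_q m.
Proof.
move=> /slow_inv_le h; have /andP[a b] := slow_inv m; have /andP[c d] := slow_inv n.
rewrite /slow_q ler_pM2l//; rewrite lef_pV2 ?posrE; lra.
Qed.

Lemma slow_pq n : (slow_p n)^-1 - (slow_q n)^-1 = (slow_sqrt n)^-1.
Proof. by rewrite /slow_p /slow_q !invf_div; move: (slow_sqrt n)^-1 => d; field. Qed.

Definition slow_params : tree_params R := TreeParams slow_p_ge1 slow_q_ge1.

Lemma slow_p_tail p : p < 2 -> \forall n \near \oo, p <= slow_p n.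
Proof.
move=> p2; near=> n.
have [p0|p0] := leP p 1; first exact: le_trans p0 (slow_p_ge1 n).
have B : p / (2 - p) <= slow_sqrt n by near: n; exact: slow_sqrt_infty.
have s1 := slow_sqrt_gt1 n; have s0 : 0 < slow_sqrt n by lra.
have /andP[d0 d1] := slow_inv n.
rewrite /slow_p ler_pdivlMr; last lra.
rewrite ler_pdivrMr in B; last lra.
have E : slow_sqrt n * (slow_sqrt n)^-1 = 1 by rewrite mulfV// gt_eqF.
have := ler_wpM2r (ltW d0) B; move: (slow_sqrt n) (slow_sqrt n)^-1 E => s t E.
rewrite mulrAC E mul1r; lra.
Unshelve. all: by end_near. Qed.

Lemma slow_q_tail q : 2 < q -> \forall n \near \oo, slow_q n <= q.
Proof.
move=> q2; near=> n.
have B : q / (q - 2) <= slow_sqrt n by near: n; exact: slow_sqrt_infty.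
have s1 := slow_sqrt_gt1 n; have s0 : 0 < slow_sqrt n by lra.
have /andP[d0 d1] := slow_inv n.
rewrite /slow_q ler_pdivrMr; last lra.
rewrite ler_pdivrMr in B; last lra.
have E : slow_sqrt n * (slow_sqrt n)^-1 = 1 by rewrite mulfV// gt_eqF.
have := ler_wpM2r (ltW d0) B; move: (slow_sqrt n) (slow_sqrt n)^-1 E => s t E.
rewrite mulrAC E mul1r; lra.
Unshelve. all: by end_near. Qed.

Lemma slow_power_ge n : (0 < n)%N -> slow_sqrt n - 1 <= n%:R `^ (slow_sqrt n)^-1.
Proof.
move=> n0; rewrite /powR pnatr_eq0 gtn_eqF//.
apply: le_trans (expR_ge1Dx _).
have s1 := slow_sqrt_gt1 n; have s0 : 0 < slow_sqrt n by lra.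
have -> : ln n%:R = slow_sqrt n ^+ 2 - 2 by rewrite slow_sqrt_sqr addrC addKr.
have /andP[d0 d1] := slow_inv n.
have -> : (slow_sqrt n)^-1 * (slow_sqrt n ^+ 2 - 2) = slow_sqrt n - 2 * (slow_sqrt n)^-1.
  by field; rewrite gt_eqF.
lra.
Qed.

End SlowlyVaryingExponents.

Theorem corollary5p4 (R : realType) (F : scalar_kind) :
  (forall p q : R, 1 < p -> p < 2 -> 2 < q ->
     exists X : completeNormedModType (scalars R F),
       [/\ convexity_power_type X q, smoothness_power_type X p
         & exists2 c : R, 0 < c & forall n : nat, (1 <= n)%N ->
             ((c^-1 * n%:R `^ (p^-1 - q^-1))%:E <= RUMD X n)%E /\
             (RUMD X n <= (c * n%:R `^ (p^-1 - q^-1))%:E)%E]) /\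
  (exists X : completeNormedModType (scalars R F),
     (forall p q : R, 1 < p -> p < 2 -> 2 < q ->
        convexity_power_type X q /\ smoothness_power_type X p) /\
     RUMD X n @[n --> \oo] --> +oo%E).
Proof.
split.
  move=> p q p1 /ltW p2 /ltW q2.
  have p1' := ltW p1; have q1 : 1 <= q by lra.
  pose P : tree_params R := TreeParams (fun=> p1') (fun=> q1).
  have hp k : p <= tp P k <= q by rewrite /= lexx (le_trans p2).
  have hq k : p <= tq P k <= q by rewrite /= lexx (le_trans p2).
  exists (banach_tree_space F P); split.
  - exact: (@tree_space_convexity R F P 0 p q).
  - exact: (@tree_space_smoothness R F P 0 p q).
  have [c c0 tp2] := @tree_space_two_point R F P p q p1 p2 q2 hp hq.
  have c2 : 0 < 8 + c ^+ 2 by rewrite ltr_wpDr ?sqr_ge0.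
  exists (8 + c ^+ 2) => // n n1; split.
    apply: le_trans _ (@RUMD_ge R F P n p q n1 p1' q1 (fun _ _ => lexx _) (fun _ _ => lexx _)).
    rewrite lee_fin ler_wpM2r ?powR_ge0// lef_pV2 ?posrE//.
    by rewrite lerDl sqr_ge0.
  apply: le_trans (RUMD_le (lt_trans ltr01 p1) p2 q2 c0 tp2 n1) _.
  by rewrite lee_fin ler_wpM2r ?powR_ge0// lerDr.
exists (banach_tree_space F slow_params); split.
  move=> p q p1 p2 q2.
  have [K1 _ hK1] := slow_p_tail p2; have [K2 _ hK2] := slow_q_tail q2.
  have hp k : (maxn K1 K2 <= k)%N -> p <= tp (@slow_params R) k <= q.
    rewrite geq_max => /andP[k1 k2]; rewrite (hK1 k k1)/= (le_trans (slow_p_le2 k))//.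
    exact: ltW.
  have hq k : (maxn K1 K2 <= k)%N -> p <= tq (@slow_params R) k <= q.
    rewrite geq_max => /andP[k1 k2]; rewrite (hK2 k k2) andbT.
    exact: le_trans (ltW p2) (slow_q_ge2 k).
  split; first exact: (@tree_space_convexity R F _ _ _ _ p1 (ltW p2) (ltW q2) hp hq).
  exact: (@tree_space_smoothness R F _ _ _ _ p1 (ltW p2) (ltW q2) hp hq).
apply/cvgeyPge => A; near=> n.
have n0 : (0 < n)%N by near: n; exact: nbhs_infty_gt.
apply: le_trans _ (@RUMD_ge R F slow_params n (slow_p n) (slow_q n) n0
  (slow_p_ge1 n) (slow_q_ge1 n) (fun j jn => slow_p_le (ltnW jn)) (fun j jn => slow_q_le (ltnW jn))).
rewrite slow_pq lee_fin.
have : 8 * A + 1 <= slow_sqrt n by near: n; exact: slow_sqrt_infty.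
rewrite ler_pdivlMl// => As; apply: le_trans (slow_power_ge n0).
by rewrite lerBrDr.
Unshelve. all: by end_near. Qed.
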